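(* Let $n\ge1$ be an integer, $\alpha\in[-2(\sqrt2-1),2(\sqrt2-1)]$ and $t\in[0,1]$. For $i=1,2$ let $f_{i,n}=h_{i,n}+\overline{g_{i,n}}$ be a normalized harmonic mapping on $\mathbb{D}$ with $$h_{i,n}(z)+g_{i,n}(z)=\left(\frac{z\left(\prod_{k=1}^{n-1}(1+z^{2^k})\right)\left(1+z^{2^n}+\alpha z^{2^{n-1}}\right)}{1+z^{2^{n+1}}}\right)*\log\frac1{1-z}$$ and dilatation $\omega_i=g_{i,n}'/h_{i,n}'$. If $|\omega_i(z)|<1$ in $\mathbb{D}$ for $i=1,2$, then the convex combination $f=tf_{1,n}+(1-t)f_{2,n}$ belongs to $\mathcal{S}_H$ and is convex in the direction of the imaginary axis.
   Context: $\mathbb{D}=\{z\in\mathbb{C}:|z|<1\}$. Harmonic functions on $\mathbb{D}$ are written $f=h+\overline{g}$ with $h,g$ analytic on $\mathbb{D}$; the dilatation is $\omega=g'/h'$. ''Normalized'' means $h(0)=g(0)=0$ and $h'(0)=1$. $\mathcal{S}_H$ is the class of harmonic, sense-preserving, univalent (injective) mappings $f$ on $\mathbb{D}$ with $f(0)=0$, $f_z(0)=1$. The Hadamard product of $\sum_{k\ge1}a_kz^k$ and $\sum_{k\ge1}b_kz^k$ is $\sum_{k\ge1}a_kb_kz^k$. Empty products equal $1$ (so for $n=1$ the numerator is $z(1+z^2+\alpha z)$). A univalent mapping of $\mathbb{D}$ is convex in the direction of the imaginary axis if the intersection of its image with every vertical line is connected or empty. *)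

(* Defs.v *)
From Stdlib Require Import Reals.
From Coquelicot Require Import Coquelicot Iter.

Local Open Scope C_scope.

Definition disk (z : C) : Prop := (Cmod z < 1)%R.

Definition analytic_on_disk (h : C -> C) : Prop :=
  forall z, disk z -> ex_derive (K := C_AbsRing) (V := C_NormedModule) h z.

Definition harmonic_sum (h g : C -> C) : C -> C := fun z => h z + Cconj (g z).

Definition harmonic_on_disk (f : C -> C) : Prop :=
  exists h g, analytic_on_disk h /\ analytic_on_disk g /\
    forall z, disk z -> f z = harmonic_sum h g z.

Definition normalized (h g : C -> C) : Prop :=
  h 0 = 0 /\ g 0 = 0 /\ C_derive h 0 = 1.

(* [w] is the quotient g'/h', with removable singularities removed; the
   equation is multiplied out because division in [C] is total, so that
   [g' / h'] would take a junk value, not a pole, at a zero of h'. *)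
Definition is_dilatation (h g w : C -> C) : Prop :=
  analytic_on_disk w /\
  forall z, disk z -> C_derive g z = w z * C_derive h z.

(* [f] is real-differentiable at [z], with f_z = [a] and f_zbar = [b]. *)
Definition is_wirtinger (f : C -> C) (z a b : C) : Prop :=
  filterdiff (K := R_AbsRing) (U := C_R_NormedModule) (V := C_R_NormedModule)
    f (locally z) (fun u : C => a * u + b * Cconj u).

(* The Jacobian |f_z|^2 - |f_zbar|^2 is positive on the disk. *)
Definition sense_preserving (f : C -> C) : Prop :=
  forall z, disk z ->
    exists a b, is_wirtinger f z a b /\ (0 < Cmod a ^ 2 - Cmod b ^ 2)%R.

Definition univalent (f : C -> C) : Prop :=
  forall z1 z2, disk z1 -> disk z2 -> f z1 = f z2 -> z1 = z2.

Definition in_SH (f : C -> C) : Prop :=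
  harmonic_on_disk f /\ sense_preserving f /\ univalent f /\
  f 0 = 0 /\ exists b, is_wirtinger f 0 1 b.

Definition connected (E : C -> Prop) : Prop :=
  forall U V : C -> Prop,
    open (T := C_UniformSpace) U -> open (T := C_UniformSpace) V ->
    (forall w, E w -> U w \/ V w) ->
    (exists w, E w /\ U w) -> (exists w, E w /\ V w) ->
    exists w, E w /\ U w /\ V w.

Definition convex_imaginary_direction (f : C -> C) : Prop :=
  forall c : R,
    let E := fun w : C => Re w = c /\ exists z, disk z /\ f z = w in
    connected E \/ (forall w, ~ E w).

(* F(z) = sum_{k >= 1} a_k z^k on the disk. *)
Definition has_expansion (a : nat -> C) (F : C -> C) : Prop :=
  a 0%nat = 0 /\
  forall z : C, disk z ->
    is_pseries (K := C_AbsRing) (V := C_NormedModule) a z (F z).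

Definition is_hadamard_product (F G H : C -> C) : Prop :=
  exists a b : nat -> C,
    has_expansion a F /\ has_expansion b G /\
    has_expansion (fun k => a k * b k) H.

(* Principal logarithm on the right half-plane {Re w > 0}; for z in the disk,
   Re (1 / (1 - z)) > 1/2. *)
Definition Clog_right (w : C) : C := (ln (Cmod w), atan (Im w / Re w)).

Definition log_kernel (z : C) : C := Clog_right (1 / (1 - z)).

Definition phi_kernel (n : nat) (alpha : R) (z : C) : C :=
  z * iter_nat Cmult 1 (fun k => 1 + Cpow z (2 ^ k)) 1 (n - 1)
    * (1 + Cpow z (2 ^ n) + alpha * Cpow z (2 ^ (n - 1)))
  / (1 + Cpow z (2 ^ (n + 1))).

(* Main.v *)
(* For both indices the Hadamard product with log (1 / (1 - z)) says that
   H = h + g satisfies z H' = Phi. Telescoping the product gives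
   (1 - z^2) H' = P(w) with w = z^(2^(n-1)) and
   P(w) = (1 - w^2) (1 + w^2 + alpha w) / (1 + w^4), and Re P > 0 on the disk as
   soon as |alpha| <= 1. In the coordinate q = (1 + z) / (1 - z) of the right
   half-plane this says that Re H increases along every ray from the origin;
   since H' is bounded near 1 and -1, the end values of Re H do not depend on
   the ray, so every nonempty level set of Re f = Re H meets each ray exactly
   once. The two maps share H, hence |g'| < |h'| passes to the combination f in
   the form Re ((h' - g') conj H') > 0. So Im f = Im (h - g) is continuous and
   strictly increasing in the slope of the ray along each level curve, which
   gives both the univalence of f and the connectedness of its vertical
   sections. *)

Require Import Defs.
From Stdlib Require Import Reals Ranalysis5 Lra Lia.
From Stdlib Require Import Classical ClassicalEpsilon FunctionalExtensionality.
From Coquelicot Require Import Coquelicot Iter.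

Local Open Scope R_scope.

Local Notation is_derive_C := (is_derive (K := C_AbsRing) (V := C_NormedModule)).

(** * Complex derivatives *)

(** Unfolds the filter definition into the first-order estimate from which all later bounds
    start. *)
Lemma is_derive_C_eps (f : C -> C) (z p : C) :
  is_derive_C f z p <->
  forall eps, 0 < eps -> exists d, 0 < d /\ forall w : C, Cmod (w - z) < d ->
    Cmod (f w - f z - p * (w - z)) <= eps * Cmod (w - z).
Proof.
split.
- intros [_ H] eps Heps.
  destruct (H z (fun P HP => HP) (mkposreal eps Heps)) as [d Hd].
  exists d; split; [apply cond_pos|]. intros w Hw.
  specialize (Hd w Hw).
  replace (f w - f z - p * (w - z))%C with (f w - f z - (w - z) * p)%C by ring.
  exact Hd.
- intros H; split.
  + apply is_linear_scal_l.
  + intros x Hx. rewrite <- (is_filter_lim_locally_unique _ _ Hx).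
    intros eps. destruct (H eps (cond_pos eps)) as (d & d0 & Hd).
    exists (mkposreal d d0). intros w Hw. specialize (Hd w Hw).
    replace (f w - f z - p * (w - z))%C with (f w - f z - (w - z) * p)%C in Hd by ring.
    exact Hd.
Qed.

Lemma C_derive_spec (h : C -> C) (z : C) :
  analytic_on_disk h -> disk z ->
  is_derive_C h z (C_derive h z).
Proof. intros Hh Hz. exact (C_derive_correct h z z (Hh z Hz)). Qed.

(** Conjugation preserves the modulus of the first-order error of [g], so the errors of [h] and [g]
    simply add. *)
Lemma is_wirtinger_harmonic_sum (h g : C -> C) (z a b : C) :
  is_derive_C h z a ->
  is_derive_C g z b ->
  is_wirtinger (harmonic_sum h g) z a (Cconj b).
Proof.
intros H1 H2.
assert (Hh := proj1 (is_derive_C_eps _ _ _) H1).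
assert (Hg := proj1 (is_derive_C_eps _ _ _) H2). split.
- split.
  + intros x y. unfold plus; simpl. unfold prod_plus, plus; simpl.
    apply injective_projections; simpl; ring.
  + intros k x. unfold scal; simpl. unfold prod_scal, scal, mult; simpl.
    unfold mult; simpl.
    apply injective_projections; simpl; ring.
  + exists (Cmod a + Cmod b + 1). split.
    { generalize (Cmod_ge_0 a) (Cmod_ge_0 b); lra. }
    intros x. rewrite <- !Cmod_norm.
    eapply Rle_trans; [apply Cmod_triangle|].
    rewrite !Cmod_mult, !Cmod_conj. generalize (Cmod_ge_0 x); nra.
- intros x Hx. rewrite <- (is_filter_lim_locally_unique _ _ Hx).
  intros [eps Heps]. simpl.
  destruct (Hh (eps / 2)) as (d & d0 & Hd); [lra|].
  destruct (Hg (eps / 2)) as (e & e0 & He); [lra|].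
  (* Balls of the real structure on C are squares. Since sqrt 2 < 2, half the radius keeps the
     square inside the disc of radius [Rmin d e]. *)
  assert (r0 : 0 < Rmin d e / 2) by (generalize (Rmin_pos d e d0 e0); lra).
  exists (mkposreal _ r0). intros w [Hw1 Hw2].
  change (Rabs (fst w - fst z) < Rmin d e / 2) in Hw1.
  change (Rabs (snd w - snd z) < Rmin d e / 2) in Hw2.
  assert (Hw : Cmod (w - z) < Rmin d e).
  { eapply Rle_lt_trans; [apply Cmod_2Rmax|].
    assert (sqrt 2 < 2) by (rewrite <- (sqrt_Rsqr 2) at 2; [apply sqrt_lt_1; unfold Rsqr; lra|lra]).
    assert (Hm : Rmax (Rabs (fst (w - z)%C)) (Rabs (snd (w - z)%C)) < Rmin d e / 2)
      by (apply Rmax_lub_lt; assumption).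
    generalize (sqrt_pos 2)
      (Rle_trans _ _ _ (Rabs_pos _)
        (Rmax_l (Rabs (fst (w - z)%C)) (Rabs (snd (w - z)%C)))); nra. }
  rewrite <- !Cmod_norm.
  specialize (Hd w (Rlt_le_trans _ _ _ Hw (Rmin_l _ _))).
  specialize (He w (Rlt_le_trans _ _ _ Hw (Rmin_r _ _))).
  rewrite <- Cmod_conj in He.
  change (Cmod (harmonic_sum h g w - harmonic_sum h g z - (a * (w - z) + Cconj b * Cconj (w - z)))
     <= eps * Cmod (w - z)).
  unfold harmonic_sum.
  replace (h w + Cconj (g w) - (h z + Cconj (g z)) - (a * (w - z) + Cconj b * Cconj (w - z)))%C
   with ((h w - h z - a * (w - z)) + Cconj (g w - g z - b * (w - z)))%C.
  + eapply Rle_trans; [apply Cmod_triangle|]. lra.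
  + rewrite !Cminus_conj, Cmult_conj, Cminus_conj. ring.
Qed.

(** The bridge to real calculus: the chain rule along the line [q] with direction [u], for the real
    part. *)
Lemma is_derive_Re_line (f : C -> C) (u : C) (q : R -> C) (s : R) (p : C) :
  is_derive_C f (q s) p ->
  (forall x, q x = q s + (x - s)%R * u)%C ->
  is_derive (fun x => Re (f (q x))) s (Re (p * u)).
Proof.
intros Hf0 Hq. assert (Hf := proj1 (is_derive_C_eps _ _ _) Hf0). apply is_derive_Reals.
intros eps Heps.
assert (Hu := Cmod_ge_0 u).
(* Adding 1 to [Cmod u] covers [u = 0]; the factor 2 leaves room for the strict inequality at the
   end. *)
destruct (Hf (eps / (2 * (Cmod u + 1)))) as (d & d0 & Hd).
{ apply Rdiv_lt_0_compat; lra. }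
assert (r0 : 0 < d / (Cmod u + 1)) by (apply Rdiv_lt_0_compat; lra).
exists (mkposreal _ r0). intros x x0 Hx. simpl in Hx.
assert (Hz : (q (s + x)%R - q s = x * u)%C).
{ rewrite (Hq (s + x)). replace (s + x - s) with x by ring. ring. }
assert (Hm : Cmod (q (s + x)%R - q s) = Rabs x * Cmod u)
  by (rewrite Hz, Cmod_mult, Cmod_R; reflexivity).
assert (Hx' : Rabs x * (Cmod u + 1) < d).
{ apply Rmult_lt_reg_r with (/ (Cmod u + 1)); [apply Rinv_0_lt_compat; lra|].
  rewrite Rmult_assoc, Rinv_r by lra. unfold Rdiv in Hx. lra. }
assert (ax := Rabs_pos_lt x x0).
specialize (Hd (q (s + x))). rewrite Hm in Hd.
assert (HH : Cmod (f (q (s + x)%R) - f (q s) - p * (q (s + x)%R - q s)) <=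
   eps / (2 * (Cmod u + 1)) * (Rabs x * Cmod u)) by (apply Hd; nra).
clear Hd.
assert (Hr := Rle_trans _ _ _ (re_le_Cmod _) HH).
rewrite Hz in Hr.
replace (Re (f (q (s + x)%R) - f (q s) - p * (x * u))%C)
  with (x * ((Re (f (q (s + x)%R)) - Re (f (q s))) / x - Re (p * u)))%R in Hr.
2:{ unfold Re; simpl. field. exact x0. }
rewrite Rabs_mult in Hr.
apply Rmult_lt_reg_l with (Rabs x); [exact ax|].
eapply Rle_lt_trans; [exact Hr|].
replace (eps / (2 * (Cmod u + 1)) * (Rabs x * Cmod u))
  with ((Rabs x * eps) * (Cmod u / (2 * (Cmod u + 1)))) by (field; lra).
assert (Cmod u / (2 * (Cmod u + 1)) < 1).
{ apply Rmult_lt_reg_r with (2 * (Cmod u + 1)); [lra|]. unfold Rdiv.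
  rewrite Rmult_assoc, Rinv_l by lra. lra. }
assert (0 < Rabs x * eps) by nra. nra.
Qed.

Lemma is_derive_C_lin (f g : C -> C) (c d z a b : C) :
  is_derive_C f z a ->
  is_derive_C g z b ->
  is_derive_C (fun w => c * f w + d * g w)%C z (c * a + d * b)%C.
Proof.
intros Hf Hg. apply is_derive_C_eps. intros eps Heps.
assert (c0 := Cmod_ge_0 c). assert (d0 := Cmod_ge_0 d).
set (e := eps / (Cmod c + Cmod d + 1)).
assert (e0 : 0 < e) by (apply Rdiv_lt_0_compat; lra).
assert (Ee : e * (Cmod c + Cmod d + 1) = eps) by (unfold e; field; lra).
destruct (proj1 (is_derive_C_eps _ _ _) Hf e e0) as (d1 & d10 & D1).
destruct (proj1 (is_derive_C_eps _ _ _) Hg e e0) as (d2 & d20 & D2).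
exists (Rmin d1 d2). split; [apply Rmin_pos; lra|]. intros w Hw.
specialize (D1 w (Rlt_le_trans _ _ _ Hw (Rmin_l _ _))).
specialize (D2 w (Rlt_le_trans _ _ _ Hw (Rmin_r _ _))).
replace (c * f w + d * g w - (c * f z + d * g z) - (c * a + d * b) * (w - z))%C
  with (c * (f w - f z - a * (w - z)) + d * (g w - g z - b * (w - z)))%C by ring.
eapply Rle_trans; [apply Cmod_triangle|]. rewrite !Cmod_mult.
assert (w0 := Cmod_ge_0 (w - z)).
apply Rle_trans with (Cmod c * (e * Cmod (w - z)) + Cmod d * (e * Cmod (w - z))).
- apply Rplus_le_compat; apply Rmult_le_compat_l; assumption.
- rewrite <- Ee. nra.
Qed.

Lemma is_derive_C_scal (f : C -> C) (c z a : C) :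
  is_derive_C f z a ->
  is_derive_C (fun w => c * f w)%C z (c * a)%C.
Proof.
intros Hf.
replace (c * a)%C with (c * a + 0 * a)%C by ring.
apply is_derive_ext with (fun w => c * f w + 0 * f w)%C.
- intros w. change (c * f w + 0 * f w = c * f w)%C. ring.
- apply is_derive_C_lin; exact Hf.
Qed.

Lemma is_derive_C_comp (f g : C -> C) (z a b : C) :
  is_derive_C f (g z) a ->
  is_derive_C g z b ->
  is_derive_C (fun w => f (g w)) z (a * b)%C.
Proof.
intros Hf Hg. rewrite Cmult_comm.
apply (is_derive_comp (K := C_AbsRing) (V := C_NormedModule) f g z a b Hf).
(* The inner derivative is wanted in C as a module over itself instead of [C_NormedModule]; only the
   linearity half has to be proved again. *)
split; [apply is_linear_scal_l | exact (proj2 Hg)].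
Qed.

(** The real mean value theorem applied to Re H on the segment from [z'] to [z]. *)
Lemma Re_mean_value (H hd : C -> C) (M : R) (z z' : C) :
  (forall s, 0 <= s <= 1 ->
    is_derive_C H (z' + s * (z - z'))%C
      (hd (z' + s * (z - z'))%C) /\ Cmod (hd (z' + s * (z - z'))%C) <= M) ->
  Re (H z) - Re (H z') <= M * Cmod (z - z').
Proof.
intros HH. set (q := fun s : R => (z' + s * (z - z'))%C) in *.
assert (D : forall s, 0 <= s <= 1 ->
  is_derive (fun s => Re (H (q s))) s (Re (hd (q s) * (z - z')))).
{ intros s Hs. apply is_derive_Re_line; [apply HH, Hs|].
  intros x. unfold q. rewrite RtoC_minus. ring. }
destruct (MVT_gen (fun s => Re (H (q s))) 0 1 (fun s => Re (hd (q s) * (z - z'))))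
  as (s & Hs & E).
- intros s. rewrite Rmin_left, Rmax_right by lra. intros Hs. apply D. lra.
- intros s. rewrite Rmin_left, Rmax_right by lra. intros Hs.
  apply continuity_pt_filterlim, @ex_derive_continuous. eexists. apply D, Hs.
- rewrite Rmin_left, Rmax_right in Hs by lra.
  replace (q 1) with z in E by (unfold q; ring).
  replace (q 0) with z' in E by (unfold q; ring).
  rewrite E. destruct (HH s Hs) as [_ B].
  assert (T := re_le_Cmod (hd (q s) * (z - z'))). rewrite Cmod_mult in T.
  apply Rabs_le_between in T. assert (P := Rmult_le_compat_r _ _ _ (Cmod_ge_0 (z - z')) B).
  fold (q s) in P. lra.
Qed.

(** * Shearing along the rays of the right half-plane *)

(** The maximum of [f] on [x, y] can only sit at [y], because immediately to the right of any other
    point [f] is larger. This turns a one-sided local comparison into global strict monotonicity. *)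
Lemma right_increasing_increasing (f : R -> R) :
  (forall x, continuity_pt f x) ->
  (forall x, exists d, 0 < d /\ forall y, x < y < x + d -> f x < f y) ->
  forall x y, x < y -> f x < f y.
Proof.
intros Hc Hr x y xy.
destruct (continuity_ab_maj f x y) as (M & HM & HMxy); [lra | intros; apply Hc |].
assert (EM : M = y).
{ destruct (Rle_lt_or_eq_dec M y) as [My | My]; [lra | | exact My].
  destruct (Hr M) as (d & d0 & Hd).
  assert (Hmin := Rmin_pos d (y - M) d0 ltac:(lra)).
  assert (Hl := Rmin_l d (y - M)). assert (Hr' := Rmin_r d (y - M)).
  specialize (Hd (M + Rmin d (y - M) / 2) ltac:(lra)).
  specialize (HM (M + Rmin d (y - M) / 2) ltac:(lra)). lra. }
subst M. destruct (Hr x) as (d & d0 & Hd).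
assert (Hmin := Rmin_pos d (y - x) d0 ltac:(lra)).
assert (Hl := Rmin_l d (y - x)). assert (Hr' := Rmin_r d (y - x)).
specialize (Hd (x + Rmin d (y - x) / 2) ltac:(lra)).
specialize (HM (x + Rmin d (y - x) / 2) ltac:(lra)). lra.
Qed.

(** If [U] and [V] separated the curve, the function [chi], equal to 0 where the curve is in [U] and
    to 1 elsewhere, would be locally constant, hence continuous, and yet would have to take the
    value 1/2. *)
Lemma connected_curve (x y : R -> R) (E : C -> Prop) :
  (forall m, continuity_pt x m) -> (forall m, continuity_pt y m) ->
  (forall w, E w <-> exists m, w = (x m, y m)) -> connected E.
Proof.
intros Hx Hy HE U V HU HV HUV (w1 & E1 & U1) (w2 & E2 & V2).
apply NNPP. intros Hno.
apply HE in E1, E2. destruct E1 as [m1 ->], E2 as [m2 ->].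
assert (Hg : forall m (W : C -> Prop), open (T := C_UniformSpace) W -> W (x m, y m) ->
  locally m (fun m' => W (x m', y m'))).
{ intros m W HW Wm. destruct (HW _ Wm) as [d Hd].
  assert (Cx := proj1 (continuity_pt_filterlim x m) (Hx m) _ (locally_ball (x m) d)).
  assert (Cy := proj1 (continuity_pt_filterlim y m) (Hy m) _ (locally_ball (y m) d)).
  apply (filter_imp (fun m' => ball (x m) d (x m') /\ ball (y m) d (y m'))).
  - intros m' [B1 B2]. apply Hd. split; assumption.
  - apply filter_and; assumption. }
assert (HE' : forall m, E (x m, y m)) by (intros m; apply HE; exists m; reflexivity).
set (chi := fun m => if excluded_middle_informative (U (x m, y m)) then 0 else 1).
assert (Hchi : continuity chi).
{ intros m. apply continuity_pt_filterlim.
  destruct (classic (U (x m, y m))) as [Um | Um].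
  - apply filterlim_ext_loc with (fun _ => chi m); [| apply filterlim_const].
    refine (filter_imp _ _ _ (Hg m U HU Um)). intros m' Um'. unfold chi.
    destruct excluded_middle_informative; [| contradiction].
    destruct excluded_middle_informative; [reflexivity | contradiction].
  - assert (Vm : V (x m, y m)) by (destruct (HUV _ (HE' m)); tauto).
    apply filterlim_ext_loc with (fun _ => chi m); [| apply filterlim_const].
    refine (filter_imp _ _ _ (Hg m V HV Vm)). intros m' Vm'. unfold chi.
    destruct excluded_middle_informative; [contradiction |].
    destruct excluded_middle_informative as [Um' |]; [| reflexivity].
    destruct Hno. exists (x m', y m'). auto. }
assert (C1 : chi m1 = 0).
{ unfold chi. destruct excluded_middle_informative; [reflexivity | contradiction]. }
assert (C2 : chi m2 = 1).
{ unfold chi. destruct excluded_middle_informative; [| reflexivity].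
  destruct Hno. exists (x m2, y m2). auto. }
destruct (IVT_gen chi m1 m2 (1 / 2) Hchi) as (m & _ & Hm).
{ rewrite C1, C2, Rmin_left, Rmax_right; lra. }
unfold chi in Hm. destruct excluded_middle_informative; lra.
Qed.

(** Polar-like coordinates with slope [m] and real part [a] in place of angle and modulus: the open
    right half-plane is exactly a > 0 with [m] an arbitrary real. *)
Definition ray (a m : R) : C := (a, a * m).

(* For [A = H o M] and [K = (h - g) o M] with M the Cayley map onto the disk,
   [sp_dir] reads Re ((1 - z^2) H'(z)) > 0 and [sp_dil] says that |g'| < |h'|;
   the last two conditions say that the behaviour of Re A at either end of a ray
   does not depend on the ray. *)
Record shear_pair (A K p k : C -> C) : Prop := {
  sp_A : forall q, 0 < Re q -> is_derive_C A q (p q);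
  sp_K : forall q, 0 < Re q -> is_derive_C K q (k q);
  sp_dir : forall q, 0 < Re q -> 0 < Re (q * p q);
  sp_dil : forall q, 0 < Re q -> 0 < Re (k q * Cconj (p q));
  sp_inf : forall m m' eps, 0 < eps -> exists b, 0 < b /\
    forall a, b <= a -> Re (A (ray a m)) < Re (A (ray a m')) + eps;
  sp_zero : forall m m' eps, 0 < eps -> exists b, 0 < b /\
    forall a, 0 < a <= b -> Re (A (ray a m)) < Re (A (ray a m')) + eps
}.

Section Shear.

Context (A K p k : C -> C) (S : shear_pair A K p k).

(** * Monotonicity of Re A along the rays *)

Lemma derive_along_ray (a m : R) : 0 < a ->
  is_derive (fun a => Re (A (ray a m))) a (Re (p (ray a m) * (1, m))).
Proof.
intros a0. apply is_derive_Re_line.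
- apply (sp_A _ _ _ _ S). exact a0.
- intros x. unfold ray. apply injective_projections; simpl; ring.
Qed.

Lemma continuity_along_ray (a m : R) : 0 < a ->
  continuity_pt (fun a => Re (A (ray a m))) a.
Proof.
intros a0. apply continuity_pt_filterlim.
apply @ex_derive_continuous. eexists. apply (derive_along_ray _ _ a0).
Qed.

Lemma continuity_across_rays (a m : R) : 0 < a ->
  continuity_pt (fun m => Re (A (ray a m))) m.
Proof.
intros a0. apply continuity_pt_filterlim.
apply @ex_derive_continuous. eexists.
apply is_derive_Re_line with (u := (0, a)).
- apply (sp_A _ _ _ _ S). exact a0.
- intros x. unfold ray. apply injective_projections; simpl; ring.
Qed.

(** Since [ray c m] is c times [(1, m)], the derivative along the ray multiplied by c is Re (q
    p(q)), which [sp_dir] makes positive. *)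
Lemma increasing_along_ray (a b m : R) : 0 < a -> a < b ->
  Re (A (ray a m)) < Re (A (ray b m)).
Proof.
intros a0 ab.
destruct (MVT_gen (fun a => Re (A (ray a m))) a b
  (fun a => Re (p (ray a m) * (1, m)))) as (c & Hc & E).
- intros x. rewrite Rmin_left, Rmax_right by lra. intros Hx.
  apply derive_along_ray. lra.
- intros x. rewrite Rmin_left, Rmax_right by lra. intros Hx.
  apply continuity_along_ray. lra.
- rewrite Rmin_left, Rmax_right in Hc by lra.
  assert (c0 : 0 < c) by lra.
  assert (Hd := sp_dir _ _ _ _ S (ray c m) c0).
  replace (Re (ray c m * p (ray c m))%C) with (c * Re (p (ray c m) * (1, m))%C) in Hd
    by (unfold Re, ray; simpl; ring).
  assert (0 < Re (p (ray c m) * (1, m))%C) by (apply Rmult_lt_reg_l with c; lra).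
  nra.
Qed.

Lemma ray_inj (a b m : R) : 0 < a -> 0 < b ->
  Re (A (ray a m)) = Re (A (ray b m)) -> a = b.
Proof.
intros a0 b0 E.
destruct (Rtotal_order a b) as [H | [H | H]]; [| exact H |].
- assert (HH := increasing_along_ray a b m a0 H). lra.
- assert (HH := increasing_along_ray b a m b0 H). lra.
Qed.

(** The ray of [q0] carries values strictly above and strictly below the level. The end conditions
    transfer both to the ray of slope [m], and the intermediate value theorem does the rest. *)
Lemma level_exists (q0 : C) (m : R) : 0 < Re q0 ->
  exists a, 0 < a /\ Re (A (ray a m)) = Re (A q0).
Proof.
intros Hq0. set (a0 := Re q0) in *. set (m0 := Im q0 / a0).
assert (Eq : q0 = ray a0 m0).
{ unfold ray, m0. apply injective_projections; simpl; [reflexivity|].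
  unfold a0, Re, Im. simpl. field. apply Rgt_not_eq. exact Hq0. }
rewrite Eq. clearbody a0 m0. clear q0 Eq.
assert (I1 := increasing_along_ray a0 (2 * a0) m0 Hq0 ltac:(lra)).
assert (I2 := increasing_along_ray (a0 / 2) a0 m0 ltac:(lra) ltac:(lra)).
(* The tolerance is the gain of Re A from [a0] to [2 * a0]. Beyond [2 * a0] the ray of [q0] exceeds
   the level by more than that, so the other ray is still above it; [a0 / 2] serves likewise
   below. *)
destruct (sp_inf _ _ _ _ S m0 m (Re (A (ray (2 * a0) m0)) - Re (A (ray a0 m0))))
  as (b & b0 & Hb); [lra|].
destruct (sp_zero _ _ _ _ S m m0 (Re (A (ray a0 m0)) - Re (A (ray (a0 / 2) m0))))
  as (b' & b'0 & Hb'); [lra|].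
set (x := Rmin b' (a0 / 4)). set (y := Rmax b (4 * a0)).
assert (x0 : 0 < x) by (apply Rmin_pos; lra).
assert (x1 : x <= b') by apply Rmin_l.
assert (x2 : x <= a0 / 4) by apply Rmin_r.
assert (y1 : b <= y) by apply Rmax_l.
assert (y2 : 4 * a0 <= y) by apply Rmax_r.
assert (J1 := increasing_along_ray (2 * a0) y m0 ltac:(lra) ltac:(lra)).
assert (J2 := increasing_along_ray x (a0 / 2) m0 ltac:(lra) ltac:(lra)).
specialize (Hb y y1). specialize (Hb' x ltac:(lra)).
destruct (IVT_interv (fun a => Re (A (ray a m)) - Re (A (ray a0 m0))) x y)
  as (z & Hz & Ez).
- intros a Ha. apply continuity_pt_minus; [apply continuity_along_ray; lra|].
  apply continuity_pt_const. intros ? ?; reflexivity.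
- lra.
- lra.
- lra.
- exists z. split; lra.
Qed.

(** * Level curves of Re A as graphs over the slope, and Im K along them *)

Lemma level_curve (q0 : C) : 0 < Re q0 ->
  exists X : R -> R, forall m, 0 < X m /\ Re (A (ray (X m) m)) = Re (A q0).
Proof.
intros Hq0.
exists (fun m => proj1_sig (constructive_indefinite_description _ (level_exists q0 m Hq0))).
intros m. destruct constructive_indefinite_description as [a Ha]. exact Ha.
Qed.

(** Re A is below [c] at real part [X m0 - e] and above it at [X m0 + e]. Both strict inequalities
    survive a small change of slope, and monotonicity along the new ray traps [X m] between the
    two. *)
Lemma level_curve_continuous (X : R -> R) (c : R) :
  (forall m, 0 < X m /\ Re (A (ray (X m) m)) = c) ->
  forall m, continuity_pt X m.
Proof.
intros HX m0 eps Heps. simpl. unfold R_dist.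
destruct (HX m0) as [X0 E0].
(* The bound [X m0 / 2] keeps [X m0 - e] in the right half-plane. *)
set (e := Rmin (eps / 2) (X m0 / 2)).
assert (e0 : 0 < e) by (apply Rmin_pos; lra).
assert (e1 : e <= eps / 2) by apply Rmin_l.
assert (e2 : e <= X m0 / 2) by apply Rmin_r.
assert (I1 := increasing_along_ray (X m0 - e) (X m0) m0 ltac:(lra) ltac:(lra)).
assert (I2 := increasing_along_ray (X m0) (X m0 + e) m0 ltac:(lra) ltac:(lra)).
destruct (continuity_across_rays (X m0 - e) m0 ltac:(lra)
  (c - Re (A (ray (X m0 - e) m0)))) as (d1 & d10 & D1); [lra|].
destruct (continuity_across_rays (X m0 + e) m0 ltac:(lra)
  (Re (A (ray (X m0 + e) m0)) - c)) as (d2 & d20 & D2); [lra|].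
exists (Rmin d1 d2). split; [apply Rmin_pos; lra|].
intros m [[_ mm0] Hm]. simpl in Hm, D1, D2. unfold R_dist in Hm, D1, D2.
assert (l1 := Rmin_l d1 d2). assert (l2 := Rmin_r d1 d2).
specialize (D1 m (conj (conj I mm0) (Rlt_le_trans _ _ _ Hm l1))).
specialize (D2 m (conj (conj I mm0) (Rlt_le_trans _ _ _ Hm l2))).
apply Rabs_def2 in D1, D2.
destruct (HX m) as [Xm Em].
apply Rle_lt_trans with e; [| lra].
apply Rabs_le. split.
- apply Rnot_lt_le. intros Hlt.
  assert (HH := increasing_along_ray (X m) (X m0 - e) m Xm ltac:(lra)). lra.
- apply Rnot_lt_le. intros Hlt.
  assert (HH := increasing_along_ray (X m0 + e) (X m) m ltac:(lra) ltac:(lra)). lra.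
Qed.

(* Writing [p q0 * (q - q0) = alpha + i beta], on the level set of Re A the real
   part alpha is of smaller order, and both Im K q - Im K q0 and the increment of
   the argument of q are positive multiples of beta up to smaller order. *)
Lemma shear_locally_increasing (q0 : C) : 0 < Re q0 ->
  exists d, 0 < d /\ forall q : C, Cmod (q - q0) < d -> Re (A q) = Re (A q0) ->
    0 < Im q * Re q0 - Re q * Im q0 -> Im (K q0) < Im (K q).
Proof.
intros Hq0.
assert (Hdir := sp_dir _ _ _ _ S q0 Hq0). assert (Hdil := sp_dil _ _ _ _ S q0 Hq0).
assert (HA := proj1 (is_derive_C_eps _ _ _) (sp_A _ _ _ _ S q0 Hq0)).
assert (HK := proj1 (is_derive_C_eps _ _ _) (sp_K _ _ _ _ S q0 Hq0)).
set (p0 := p q0) in *. set (k0 := k q0) in *.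
set (c := Re (q0 * p0)) in *. set (dd := Im (q0 * p0)).
set (e := Re (k0 * Cconj p0)) in *. set (f := Im (k0 * Cconj p0)).
set (r := Cmod p0) in *.
assert (r0 : 0 < r).
{ apply Cmod_gt_0. intros E. unfold c in Hdir. rewrite E in Hdir.
  unfold Re in Hdir; simpl in Hdir. lra. }
assert (D0 := Rabs_pos dd). assert (F0 := Rabs_pos f).
assert (r2 := Rmult_lt_0_compat r r r0 r0).
(* Here c + i dd = q0 p0 and e + i f = k0 conj(p0), with c, e > 0. The bound r/2 will give r D <= 2
   |be|, [e1] the sign of [be], and [e2] the dominance of [be * e] over all errors in Im K. *)
set (e1 := c * r / (2 * (Rabs dd + 1))).
set (e2 := e * r / (2 * (Rabs f + r * r + 1))).
assert (e1_pos : 0 < e1) by (apply Rdiv_lt_0_compat; nra).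
assert (e2_pos : 0 < e2) by (apply Rdiv_lt_0_compat; nra).
set (eps := Rmin (r / 2) (Rmin e1 e2)).
assert (eps_pos : 0 < eps) by (repeat apply Rmin_pos; lra).
assert (Er : eps <= r / 2) by apply Rmin_l.
assert (E1 : eps <= e1) by (eapply Rle_trans; [apply Rmin_r | apply Rmin_l]).
assert (E2 : eps <= e2) by (eapply Rle_trans; [apply Rmin_r | apply Rmin_r]).
assert (E1' : eps * (2 * (Rabs dd + 1)) <= c * r).
{ apply Rle_trans with (e1 * (2 * (Rabs dd + 1))); [nra|].
  right. unfold e1. field. lra. }
assert (E2' : eps * (2 * (Rabs f + r * r + 1)) <= e * r).
{ apply Rle_trans with (e2 * (2 * (Rabs f + r * r + 1))); [nra|].
  right. unfold e2. field. nra. }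
clearbody eps. clear e1 e2 e1_pos e2_pos E1 E2.
destruct (HA eps eps_pos) as (d1 & d10 & D1).
destruct (HK eps eps_pos) as (d2 & d20 & D2).
exists (Rmin d1 d2). split; [apply Rmin_pos; lra|].
intros q Hq EA Harg.
specialize (D1 q (Rlt_le_trans _ _ _ Hq (Rmin_l _ _))).
specialize (D2 q (Rlt_le_trans _ _ _ Hq (Rmin_r _ _))).
assert (R1 := Rle_trans _ _ _ (re_le_Cmod _) D1).
assert (R2 : Rabs (Im (K q - K q0 - k0 * (q - q0))%C) <= eps * Cmod (q - q0)).
{ eapply Rle_trans; [| exact D2].
  eapply Rle_trans; [apply Rmax_r | apply Rmax_Cmod]. }
clear D1 D2 HA HK.
set (al := Re (p0 * (q - q0))). set (be := Im (p0 * (q - q0))).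
set (D := Cmod (q - q0)) in *. assert (Dp : 0 <= D) by apply Cmod_ge_0.
assert (Hal : Rabs al <= eps * D).
{ replace (Re (A q - A q0 - p0 * (q - q0))%C) with (- al) in R1.
  - rewrite Rabs_Ropp in R1. exact R1.
  - unfold al. replace (Re (A q - A q0 - p0 * (q - q0))%C)
      with (Re (A q) - Re (A q0) - Re (p0 * (q - q0))%C) by (unfold Re; simpl; ring).
    lra. }
assert (HD : r * D <= Rabs al + Rabs be).
{ unfold r, D. rewrite <- Cmod_mult.
  apply Rsqr_incr_0_var; [| generalize (Rabs_pos al) (Rabs_pos be); lra].
  rewrite !Rsqr_pow2, Cmod2_alt. fold al be.
  rewrite <- (pow2_abs al), <- (pow2_abs be).
  generalize (Rabs_pos al) (Rabs_pos be); nra. }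
assert (HD' : r * D <= 2 * Rabs be) by nra.
(* Both identities come from r^2 (q - q0) = conj(p0) (al + i be), multiplied by conj(q0) for [P1]
   and by [k0] for [P2]. *)
assert (P1 : r * r * (Im q * Re q0 - Re q * Im q0) = be * c - al * dd).
{ replace (r * r) with (r ^ 2) by ring. unfold r. rewrite Cmod2_alt.
  unfold be, al, c, dd, Re, Im. simpl. ring. }
assert (P2 : r * r * Im (k0 * (q - q0))%C = be * e + al * f).
{ replace (r * r) with (r ^ 2) by ring. unfold r. rewrite Cmod2_alt.
  unfold be, al, e, f, Re, Im. simpl. ring. }
assert (P3 : Im (K q - K q0 - k0 * (q - q0))%C = Im (K q) - Im (K q0) - Im (k0 * (q - q0))%C)
  by (unfold Im; simpl; ring).
rewrite P3 in R2. apply Rabs_le_between in R2.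
assert (Q1 : al * dd <= eps * D * Rabs dd /\ - (eps * D * Rabs dd) <= al * dd).
{ assert (H : Rabs (al * dd) <= eps * D * Rabs dd) by (rewrite Rabs_mult; nra).
  apply Rabs_le_between in H. lra. }
assert (Q2 : - (eps * D * Rabs f) <= al * f).
{ assert (H : Rabs (al * f) <= eps * D * Rabs f) by (rewrite Rabs_mult; nra).
  apply Rabs_le_between in H. lra. }
assert (Harg' : 0 < be * c - al * dd) by (rewrite <- P1; nra).
(* If be <= 0, then r D <= -2 be and the choice of [e1] give eps D |dd| <= -be c, so be c - al dd <=
   0 against [Harg']. *)
assert (Hbe : 0 < be).
{ apply Rnot_le_lt. intros Hle.
  rewrite (Rabs_left1 be Hle) in HD'.
  assert (Z : r * (eps * D * Rabs dd) <= c * r * - be) by nra.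
  assert (Z' : r * (be * c + eps * D * Rabs dd) <= 0) by nra.
  nra. }
rewrite (Rabs_pos_eq be (Rlt_le _ _ Hbe)) in HD'.
(* In eps D (|f| + r^2) the term |f| accounts for [al * f] and r^2 for the first-order error of [K].
   The +1 in [e2] makes the comparison with [be * e] strict. *)
assert (Y : 0 <= eps * (Rabs f + r * r)) by (apply Rmult_le_pos; lra).
assert (Y1 := Rmult_le_compat_r _ _ _ Y HD').
assert (Y2 := Rmult_le_compat_l _ _ _ (Rlt_le _ _ Hbe) E2').
assert (Z : r * (eps * D * (Rabs f + r * r)) <= be * (e * r - 2 * eps)) by lra.
assert (Y3 := Rmult_lt_0_compat _ _ Hbe eps_pos).
assert (Z' : 0 < r * (be * e - eps * D * (Rabs f + r * r))) by lra.
assert (Z'' : 0 < be * e - eps * D * (Rabs f + r * r)) by (apply Rmult_lt_reg_l with r; lra).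
assert (W : 0 < r * r * (Im (K q) - Im (K q0))) by nra.
nra.
Qed.

Lemma level_curve_point_continuous (X : R -> R) (c : R) :
  (forall m, 0 < X m /\ Re (A (ray (X m) m)) = c) ->
  forall m0 eps, 0 < eps -> exists d, 0 < d /\ forall m, Rabs (m - m0) < d ->
    Cmod (ray (X m) m - ray (X m0) m0) < eps.
Proof.
intros HX m0 eps Heps.
assert (CX := level_curve_continuous X c HX m0).
assert (CY : continuity_pt (fun m => X m * m) m0).
{ apply continuity_pt_mult; [exact CX | apply continuity_pt_id]. }
assert (L : forall f, continuity_pt f m0 -> exists d, 0 < d /\
  forall m, Rabs (m - m0) < d -> Rabs (f m - f m0) < eps / 2).
{ intros f Hf. destruct (Hf (eps / 2)) as (d & d0 & Hd); [lra|].
  exists d. split; [exact d0|]. intros m Hm.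
  destruct (Req_dec m m0) as [-> | N].
  - rewrite Rminus_diag, Rabs_R0. lra.
  - apply (Hd m). split; [split; [exact I | congruence] | exact Hm]. }
destruct (L _ CX) as (d1 & d10 & D1). destruct (L _ CY) as (d2 & d20 & D2).
exists (Rmin d1 d2). split; [apply Rmin_pos; lra|]. intros m Hm.
specialize (D1 m (Rlt_le_trans _ _ _ Hm (Rmin_l _ _))).
specialize (D2 m (Rlt_le_trans _ _ _ Hm (Rmin_r _ _))).
replace (ray (X m) m - ray (X m0) m0)%C
  with (RtoC (X m - X m0) + Ci * RtoC (X m * m - X m0 * m0))%C
  by (unfold ray; apply injective_projections; simpl; ring).
eapply Rle_lt_trans; [apply Cmod_triangle|].
rewrite Cmod_mult, Cmod_Ci, !Cmod_R. lra.
Qed.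

(** Differentiability with tolerance 1 gives |K q - K q0| <= (|k0| + 1) |q - q0| near [q0], so the
    continuity of the point on the level curve carries over. *)
Lemma shear_continuous (X : R -> R) (c : R) :
  (forall m, 0 < X m /\ Re (A (ray (X m) m)) = c) ->
  forall m, continuity_pt (fun m => Im (K (ray (X m) m))) m.
Proof.
intros HX m0 eps Heps.
destruct (HX m0) as [X0 _].
destruct (proj1 (is_derive_C_eps _ _ _) (sp_K _ _ _ _ S (ray (X m0) m0) X0) 1)
  as (d & d0 & Hd); [lra|].
set (k0 := k (ray (X m0) m0)) in *.
assert (k00 := Cmod_ge_0 k0).
destruct (level_curve_point_continuous X c HX m0 (Rmin d (eps / (Cmod k0 + 2))))
  as (e & e0 & He).
{ apply Rmin_pos; [exact d0|]. apply Rdiv_lt_0_compat; lra. }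
exists e. split; [exact e0|]. intros m [_ Hm]. simpl in Hm |- *. unfold R_dist in *.
specialize (He m Hm).
set (D := Cmod (ray (X m) m - ray (X m0) m0)) in *.
assert (D0 : 0 <= D) by apply Cmod_ge_0.
assert (He1 := Rlt_le_trans _ _ _ He (Rmin_l _ _)).
assert (He2 := Rlt_le_trans _ _ _ He (Rmin_r _ _)).
specialize (Hd _ He1).
assert (HD : D * (Cmod k0 + 2) < eps).
{ apply Rmult_lt_reg_r with (/ (Cmod k0 + 2)); [apply Rinv_0_lt_compat; lra|].
  rewrite Rmult_assoc, Rinv_r by lra. unfold Rdiv in He2. lra. }
replace (Im (K (ray (X m) m)) - Im (K (ray (X m0) m0)))
  with (Im (K (ray (X m) m) - K (ray (X m0) m0))%C) by (unfold Im; simpl; ring).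
apply Rle_lt_trans with (Cmod (K (ray (X m) m) - K (ray (X m0) m0))).
{ eapply Rle_trans; [apply Rmax_r | apply Rmax_Cmod]. }
replace (K (ray (X m) m) - K (ray (X m0) m0))%C
 with ((K (ray (X m) m) - K (ray (X m0) m0) - k0 * (ray (X m) m - ray (X m0) m0))
   + k0 * (ray (X m) m - ray (X m0) m0))%C by ring.
eapply Rle_lt_trans; [apply Cmod_triangle|].
rewrite (Cmod_mult k0). fold D. fold D in Hd. nra.
Qed.

(** For two points of the curve, Im q Re q0 - Re q Im q0 = X m X m0 (m - m0), so the local
    comparison applies to every slightly larger slope. *)
Lemma shear_increasing (X : R -> R) (c : R) :
  (forall m, 0 < X m /\ Re (A (ray (X m) m)) = c) ->
  forall m m', m < m' -> Im (K (ray (X m) m)) < Im (K (ray (X m') m')).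
Proof.
intros HX. apply right_increasing_increasing; [apply (shear_continuous X c HX)|].
intros m0. destruct (HX m0) as [X0 E0].
destruct (shear_locally_increasing (ray (X m0) m0) X0) as (d & d0 & Hd).
destruct (level_curve_point_continuous X c HX m0 d d0) as (e & e0 & He).
exists e. split; [exact e0|]. intros m Hm. destruct (HX m) as [Xm Em].
apply Hd.
- apply He. rewrite Rabs_pos_eq; lra.
- congruence.
- unfold Im, Re, ray; simpl.
  replace (X m * m * X m0 - X m * (X m0 * m0)) with (X m * X m0 * (m - m0)) by ring.
  apply Rmult_lt_0_compat; [apply Rmult_lt_0_compat; assumption | lra].
Qed.

(** * Injectivity and connected vertical sections *)

Lemma ray_of (q : C) : 0 < Re q -> q = ray (Re q) (Im q / Re q).
Proof.
intros Hq. unfold ray. apply injective_projections; simpl; [reflexivity|].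
unfold Re, Im in *. field. lra.
Qed.

(** Points with equal Re A lie on one level curve, where strict monotonicity of Im K forces equal
    slopes. *)
Lemma shear_injective (q q' : C) : 0 < Re q -> 0 < Re q' ->
  Re (A q) = Re (A q') -> Im (K q) = Im (K q') -> q = q'.
Proof.
intros Hq Hq' EA EK.
destruct (level_curve q Hq) as [X HX].
assert (HXq : forall q1, 0 < Re q1 -> Re (A q1) = Re (A q) ->
  q1 = ray (X (Im q1 / Re q1)) (Im q1 / Re q1)).
{ intros q1 H1 E1. destruct (HX (Im q1 / Re q1)) as [X1 F1].
  rewrite (ray_of q1 H1) at 1. f_equal.
  apply (ray_inj _ _ (Im q1 / Re q1)); [exact H1 | exact X1 |].
  rewrite <- (ray_of q1 H1). congruence. }
assert (Q := HXq q Hq eq_refl). assert (Q' := HXq q' Hq' (eq_sym EA)).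
set (m := Im q / Re q) in *. set (m' := Im q' / Re q') in *.
rewrite Q, Q' in EK |- *.
destruct (Rtotal_order m m') as [H | [-> | H]]; [| reflexivity |].
- assert (HH := shear_increasing X _ HX m m' H). lra.
- assert (HH := shear_increasing X _ HX m' m H). lra.
Qed.

(** A nonempty section is the whole curve m -> (c, Im K) traced along one level curve, because that
    curve meets each ray exactly once. *)
Lemma shear_level_connected (E : C -> Prop) (c : R) :
  (forall w, E w <-> Re w = c /\ exists q, 0 < Re q /\ w = (Re (A q), Im (K q))) ->
  connected E \/ (forall w, ~ E w).
Proof.
intros HE.
destruct (classic (exists w, E w)) as [[w0 Hw0] | N];
  [left | right; intros w Hw; apply N; exists w; exact Hw].
apply HE in Hw0. destruct Hw0 as [Ew0 (q0 & Hq0 & ->)]. simpl in Ew0.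
destruct (level_curve q0 Hq0) as [X HX]. rewrite Ew0 in HX.
apply connected_curve with (x := fun _ => c) (y := fun m => Im (K (ray (X m) m))).
- intros m. apply continuity_pt_const. intros ? ?; reflexivity.
- apply (shear_continuous X c HX).
- intros w. split.
  + intros Hw. apply HE in Hw. destruct Hw as [Ew (q & Hq & ->)].
    simpl in Ew. exists (Im q / Re q). f_equal; [exact Ew|]. do 2 f_equal.
    rewrite (ray_of q Hq) at 1. f_equal.
    destruct (HX (Im q / Re q)) as [X1 F1].
    apply (ray_inj _ _ (Im q / Re q)); [exact Hq | exact X1 |].
    rewrite <- (ray_of q Hq). congruence.
  + intros [m ->]. apply HE. split; [reflexivity|].
    destruct (HX m) as [X1 F1]. exists (ray (X m) m). split; [exact X1|].
    rewrite F1. reflexivity.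
Qed.

End Shear.

(** * Hadamard products with the logarithm *)

(** Complex series are tested against the real functionals [Re (xi * _)], which brings them under
    the theory of real power series; [C_ext_Re] recovers the complex identity. *)
Lemma is_series_Re_mult (c : nat -> C) (xi l : C) :
  is_series (K := C_AbsRing) (V := C_NormedModule) c l ->
  is_series (fun k => Re (xi * c k)) (Re (xi * l)).
Proof.
intros H.
assert (H1 : is_series (fun k => Re (c k)) (Re l)).
{ apply filterlim_ext with (fun n => fst (sum_n (G := C_NormedModule) c n)).
  - induction x as [| x IH]; [rewrite !sum_O; reflexivity|].
    rewrite !sum_Sn, <- IH. reflexivity.
  - eapply filterlim_comp; [exact H|].
    intros P [e He]. exists e. intros y [Hy _]. exact (He _ Hy). }
assert (H2 : is_series (fun k => Im (c k)) (Im l)).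
{ apply filterlim_ext with (fun n => snd (sum_n (G := C_NormedModule) c n)).
  - induction x as [| x IH]; [rewrite !sum_O; reflexivity|].
    rewrite !sum_Sn, <- IH. reflexivity.
  - eapply filterlim_comp; [exact H|].
    intros P [e He]. exists e. intros y [_ Hy]. exact (He _ Hy). }
assert (H3 := is_series_minus _ _ _ _ (is_series_scal (Re xi) _ _ H1)
                (is_series_scal (Im xi) _ _ H2)).
exact H3.
Qed.

(** Convergence at [s'], the midpoint of |s| and r, makes the terms there tend to 0, which is
    impossible outside the disk of convergence. *)
Lemma CV_radius_gt (u : nat -> R) (r : R) :
  (forall s, Rabs s < r -> ex_pseries u s) ->
  forall s, Rabs s < r -> Rbar_lt (Rabs s) (CV_radius u).
Proof.
intros H s Hs. assert (s0 := Rabs_pos s).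
set (s' := (Rabs s + r) / 2).
assert (Es' : Rabs s' = s') by (apply Rabs_pos_eq; unfold s'; lra).
destruct (Rbar_lt_dec (CV_radius u) (Rabs s')) as [Hlt | Hge].
- destruct (CV_disk_outside u s' Hlt).
  apply ex_series_lim_0.
  destruct (H s') as [l Hl]; [rewrite Es'; unfold s'; lra|].
  exists l. apply is_pseries_R. exact Hl.
- apply Rbar_not_lt_le in Hge. eapply Rbar_lt_le_trans; [| exact Hge].
  rewrite Es'. unfold s'. simpl. lra.
Qed.

Lemma is_derive_pseries (u : nat -> R) (U : R -> R) (r : R) :
  (forall s, Rabs s < r -> is_pseries u s (U s)) ->
  forall s, Rabs s < r -> is_derive U s (PSeries (PS_derive u) s).
Proof.
intros H s Hs.
apply is_derive_ext_loc with (PSeries u).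
- assert (d0 : 0 < r - Rabs s) by lra.
  exists (mkposreal _ d0). intros x Hx. apply is_pseries_unique, H.
  change (Rabs (x - s) < r - Rabs s) in Hx.
  generalize (Rabs_triang s (x - s)). rewrite (Rplus_minus s x). lra.
- apply is_derive_PSeries. apply CV_radius_gt with r; [| exact Hs].
  intros x Hx. eexists. apply H. exact Hx.
Qed.

(** Multiplying the k-th coefficient by k is the Euler operator s d/ds. At s = 0 the relation
    [V s = s * d] leaves [d] undetermined; the last clause fixes it, since both derivatives at 0
    equal the coefficient [u 1]. *)
Lemma real_euler_derive (u v : nat -> R) (U V : R -> R) (r : R) :
  (forall s, Rabs s < r -> is_pseries u s (U s)) ->
  (forall s, Rabs s < r -> is_pseries v s (V s)) ->
  (forall k, v k = INR k * u k) ->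
  forall s, Rabs s < r -> exists d, is_derive U s d /\ V s = s * d /\
    (s = 0 -> is_derive V s d).
Proof.
intros HU HV E s Hs.
exists (PSeries (PS_derive u) s). split; [| split].
- apply is_derive_pseries with r; assumption.
- rewrite <- (is_pseries_unique _ _ _ (HV s Hs)), PSeries_decr_1_aux.
  + f_equal. apply PSeries_ext. intros n. unfold PS_decr_1, PS_derive. apply E.
  + rewrite E. simpl. ring.
- intros ->. rewrite PSeries_0.
  replace (PS_derive u 0) with (PSeries (PS_derive v) 0).
  + apply is_derive_pseries with r; assumption.
  + rewrite PSeries_0. unfold PS_derive. rewrite E. apply Rmult_1_l.
Qed.

Lemma pow_n_scal (s : R) (z : C) (k : nat) :
  pow_n (K := C_AbsRing) (s * z)%C k = (RtoC (s ^ k) * pow_n (K := C_AbsRing) z k)%C.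
Proof.
induction k as [| k IH]; simpl.
- unfold one; simpl. apply injective_projections; simpl; ring.
- rewrite IH. unfold mult; simpl. rewrite RtoC_mult. ring.
Qed.

Lemma has_expansion_line (a : nat -> C) (F : C -> C) (xi z : C) (s : R) :
  has_expansion a F -> disk (s * z) ->
  is_pseries (fun k => Re (xi * (pow_n (K := C_AbsRing) z k * a k))) s
    (Re (xi * F (s * z)%C)).
Proof.
intros [_ H] Hs. apply is_pseries_R.
apply is_series_ext with
  (fun k => Re (xi * (pow_n (K := C_AbsRing) (s * z)%C k * a k))).
- intros k. rewrite pow_n_scal. unfold Re; simpl. ring.
- apply is_series_Re_mult. exact (H _ Hs).
Qed.

Lemma log_kernel_real (x : R) : Rabs x < 1 ->
  log_kernel x = RtoC (- ln (1 - x)).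
Proof.
intros Hx. apply Rabs_def2 in Hx. unfold log_kernel, Clog_right.
replace (1 / (1 - x))%C with (RtoC (/ (1 - x))).
2:{ rewrite <- RtoC_minus, <- RtoC_div by lra. apply f_equal. field. lra. }
assert (i0 : 0 < / (1 - x)) by (apply Rinv_0_lt_compat; lra).
rewrite Cmod_R, Rabs_pos_eq by lra.
unfold Im, Re, RtoC. simpl. rewrite Rdiv_0_l, atan_0, ln_Rinv by lra. reflexivity.
Qed.

(** The values on the real segment determine the coefficients: differentiating -ln (1 - s) gives the
    geometric series, and the imaginary parts form a power series that vanishes identically. *)
Lemma log_kernel_coef (b : nat -> C) : has_expansion b log_kernel ->
  forall k, b (S k) = RtoC (/ INR (S k)).
Proof.
intros Hb.
assert (L : forall xi (s : R), Rabs s < 1 ->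
  is_pseries (fun k => Re (xi * b k)) s (Re (xi * RtoC (- ln (1 - s))))).
{ intros xi s Hs. rewrite <- log_kernel_real by exact Hs.
  assert (Hd : disk (s * 1)%C) by (unfold disk; rewrite Cmult_1_r, Cmod_R; exact Hs).
  assert (H := has_expansion_line b log_kernel xi 1 s Hb Hd).
  rewrite Cmult_1_r in H. apply is_pseries_R. apply is_pseries_R in H.
  apply is_series_ext with (2 := H). intros k.
  replace (pow_n (K := C_AbsRing) (RtoC 1) k) with (RtoC 1); [rewrite Cmult_1_l; reflexivity|].
  clear. induction k as [| k IH]; [reflexivity|]. simpl. rewrite <- IH.
  symmetry. apply Cmult_1_l. }
intros k.
assert (E1 : Re (b (S k)) = / INR (S k)).
{ assert (G : forall s, Rabs s < 1 -> is_pseries (fun _ => 1) s (/ (1 - s))).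
  { intros s Hs. apply is_pseries_R.
    apply is_series_ext with (fun n => s ^ n); [intros n; symmetry; apply Rmult_1_l|].
    apply is_series_geom. exact Hs. }
  assert (D : PS_derive (fun k => Re (1 * b k)) k = 1).
  { apply (PSeries_ext_recip _ (fun _ => 1)).
    - rewrite CV_radius_derive. rewrite <- Rabs_R0. apply CV_radius_gt with 1.
      + intros s Hs. eexists. apply L. exact Hs.
      + rewrite Rabs_R0. lra.
    - rewrite <- Rabs_R0. apply CV_radius_gt with 1.
      + intros s Hs. eexists. apply G. exact Hs.
      + rewrite Rabs_R0. lra.
    - exists (mkposreal 1 Rlt_0_1). intros s Hs. change (Rabs (s - 0) < 1) in Hs.
      rewrite Rminus_0_r in Hs.
      rewrite (is_pseries_unique _ _ _ (G s Hs)).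
      assert (D1 := is_derive_pseries _ _ 1 (L 1%C) s Hs).
      apply is_derive_unique in D1. rewrite <- D1.
      apply is_derive_unique. apply Rabs_def2 in Hs.
      apply is_derive_ext with (fun s => - ln (1 - s)).
      + intros x. unfold Re; simpl. ring.
      + auto_derive; [lra | field; lra]. }
  unfold PS_derive in D. rewrite Cmult_1_l in D.
  apply Rmult_eq_reg_l with (INR (S k)); [| apply not_0_INR; lia].
  rewrite D, Rinv_r; [reflexivity | apply not_0_INR; lia]. }
assert (E2 : Im (b (S k)) = 0).
(* Testing with xi = -i turns the imaginary part into a real part. *)
{ assert (Z := PSeries_ext_recip (fun k => Re (- Ci * b k)) (fun _ => 0) (S k)).
  replace (Im (b (S k))) with (Re (- Ci * b (S k))%C) by (unfold Re, Im; simpl; ring).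
  apply Z.
  - rewrite <- Rabs_R0. apply CV_radius_gt with 1.
    + intros s Hs. eexists. apply L. exact Hs.
    + rewrite Rabs_R0. lra.
  - rewrite CV_radius_const_0. exact I.
  - exists (mkposreal 1 Rlt_0_1). intros s Hs. change (Rabs (s - 0) < 1) in Hs.
    rewrite Rminus_0_r in Hs.
    rewrite (is_pseries_unique _ _ _ (L _ s Hs)), PSeries_const_0.
    unfold Re; simpl. ring. }
apply injective_projections; assumption.
Qed.

Lemma C_ext_Re (z w : C) : (forall xi : C, Re (xi * z) = Re (xi * w)) -> z = w.
Proof.
intros H. apply injective_projections.
- assert (H1 := H 1%C). rewrite !Cmult_1_l in H1. exact H1.
- assert (H1 := H (- Ci)%C). unfold Re in H1; simpl in H1. lra.
Qed.

(** The logarithm contributes the factors 1/k, so on a line through the origin the coefficients of F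
    are k times those of H and the Euler relation holds there. *)
Lemma hadamard_log_line (F H : C -> C) (xi z : C) (s : R) :
  is_hadamard_product F log_kernel H -> disk z -> disk (s * z)%C ->
  exists d, is_derive (fun s : R => Re (xi * H (s * z)%C)) s d /\
    Re (xi * F (s * z)%C) = s * d /\
    (s = 0 -> is_derive (fun s : R => Re (xi * F (s * z)%C)) s d).
Proof.
intros (a & b & Ha & Hb & Hab) Hz Hs.
assert (Eb := log_kernel_coef b Hb).
assert (z0 := Cmod_ge_0 z). unfold disk in Hz, Hs. rewrite Cmod_mult, Cmod_R in Hs.
(* On the line the disk is |s| < 1/|z|; for z = 0 any radius above |s| will do. *)
assert (Hr : exists r, Rabs s < r /\ forall x, Rabs x < r -> disk (x * z)%C).
{ destruct (Req_dec (Cmod z) 0) as [E | N].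
  - exists (Rabs s + 1). split; [lra|]. intros x _. unfold disk.
    rewrite Cmod_mult, E. lra.
  - exists (/ Cmod z). split.
    + apply Rmult_lt_reg_r with (Cmod z); [lra|]. rewrite Rinv_l by exact N. exact Hs.
    + intros x Hx. unfold disk. rewrite Cmod_mult, Cmod_R.
      apply Rmult_lt_reg_r with (/ Cmod z); [apply Rinv_0_lt_compat; lra|].
      rewrite Rmult_assoc, Rinv_r by exact N. lra. }
destruct Hr as (r & Hsr & Hr).
apply (real_euler_derive
  (fun k => Re (xi * (pow_n (K := C_AbsRing) z k * (a k * b k))))
  (fun k => Re (xi * (pow_n (K := C_AbsRing) z k * a k)))
  (fun s : R => Re (xi * H (s * z)%C)) (fun s : R => Re (xi * F (s * z)%C)) r);
  [| | | exact Hsr].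
- intros x Hx. apply (has_expansion_line _ _ xi z x Hab). exact (Hr x Hx).
- intros x Hx. apply (has_expansion_line _ _ xi z x Ha). exact (Hr x Hx).
- intros [| k].
  + rewrite (proj1 Ha), !Cmult_0_r. simpl. ring.
  + rewrite Eb.
    replace (xi * (pow_n (K := C_AbsRing) z (S k) * (a (S k) * RtoC (/ INR (S k)))))%C
      with (RtoC (/ INR (S k)) * (xi * (pow_n (K := C_AbsRing) z (S k) * a (S k))))%C
      by ring.
    rewrite re_scal_l, <- Rmult_assoc, Rinv_r, Rmult_1_l; [reflexivity|].
    apply not_0_INR. lia.
Qed.

(** The Euler relation at s = 1 on the line through [z], with the chain rule identifying [d] as Re
    (xi p z). *)
Lemma hadamard_log_derive (F H : C -> C) (z p : C) :
  is_hadamard_product F log_kernel H -> disk z ->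
  is_derive_C H z p -> (z * p = F z)%C.
Proof.
intros HF Hz HH. apply C_ext_Re. intros xi.
assert (E1 : (RtoC 1 * z = z)%C) by ring.
assert (Hz1 : disk (1%R * z)%C) by (rewrite E1; exact Hz).
destruct (hadamard_log_line F H xi z 1 HF Hz Hz1) as (d & Hd & E & _).
rewrite E1 in E. rewrite E, Rmult_1_l.
assert (Hd' : is_derive (fun s : R => Re (xi * H (s * z)%C)) 1 (Re (xi * p * z))).
{ apply (is_derive_Re_line (fun w => xi * H w)%C z (fun s : R => s * z)%C 1 (xi * p)%C).
  - rewrite E1. apply is_derive_C_scal. exact HH.
  - intros x. rewrite RtoC_minus. ring. }
apply is_derive_unique in Hd, Hd'. rewrite <- Hd, Hd'. f_equal. ring.
Qed.

(** At the origin z H' = F only says 0 = 0, so the first-order terms are compared, along the line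
    through 1/2. *)
Lemma hadamard_log_derive_0 (F H : C -> C) (p l : C) :
  is_hadamard_product F log_kernel H ->
  is_derive_C H (RtoC 0) p ->
  is_derive_C F (RtoC 0) l -> p = l.
Proof.
intros HF HH HF0. apply C_ext_Re. intros xi.
assert (Hz : disk (/2)%R).
{ unfold disk. rewrite Cmod_R, Rabs_pos_eq; lra. }
assert (E0 : (RtoC 0 * RtoC (/2) = 0)%C) by ring.
assert (Hz0 : disk (0%R * (/2)%R)%C).
{ rewrite E0. unfold disk. rewrite Cmod_0. lra. }
destruct (hadamard_log_line F H xi (RtoC (/2)) 0 HF Hz Hz0) as (d & Hd & _ & Hd').
specialize (Hd' eq_refl).
assert (L : forall (G : C -> C) (q : C),
  is_derive_C G (RtoC 0) q ->
  is_derive (fun s : R => Re (xi * G (s * (/2)%R)%C)) 0 (Re (xi * q) / 2)).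
{ intros G q HG.
  replace (Re (xi * q)%C / 2) with (Re (xi * q * (/2)%R)%C)
    by (unfold Re; simpl; field).
  apply (is_derive_Re_line (fun w => xi * G w)%C (/2)%R (fun s : R => s * (/2)%R)%C 0 (xi * q)%C).
  - rewrite E0. apply is_derive_C_scal. exact HG.
  - intros x. rewrite RtoC_minus. ring. }
assert (L1 := L _ _ HH). assert (L2 := L _ _ HF0).
apply is_derive_unique in Hd, Hd', L1, L2. lra.
Qed.

(** * The kernel *)

Lemma Cpow_double (z : C) (m : nat) : (Cpow z (2 * m) = Cpow z m * Cpow z m)%C.
Proof. rewrite Nat.mul_comm, Cpow_mult_r. simpl. ring. Qed.

Lemma iter_nat_Cmult_S (u : nat -> C) (m : nat) :
  iter_nat Cmult 1%C u 1 (S m) = (iter_nat Cmult 1%C u 1 m * u (S m))%C.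
Proof.
rewrite (iter_nat_Chasles _ _ Cmult_1_l Cmult_assoc u 1 m (S m)) by lia.
rewrite (iter_nat_point _ _ Cmult_1_r). reflexivity.
Qed.

Lemma telescoping_product (z : C) (m : nat) :
  ((1 - z * z) * iter_nat Cmult 1 (fun k => 1 + Cpow z (2 ^ k)) 1 m
   = 1 - Cpow z (2 ^ S m))%C.
Proof.
induction m as [| m IH].
- unfold iter_nat; simpl. ring.
- rewrite iter_nat_Cmult_S, Cmult_assoc, IH.
  change (2 ^ S (S m))%nat with (2 * 2 ^ S m)%nat.
  rewrite Cpow_double. ring.
Qed.

Lemma product_bound (z : C) (m : nat) : disk z ->
  Cmod (iter_nat Cmult 1%C (fun k => 1 + Cpow z (2 ^ k))%C 1 m) <= 2 ^ m.
Proof.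
intros Hz. induction m as [| m IH].
- unfold iter_nat; simpl. rewrite Cmod_1. lra.
- rewrite iter_nat_Cmult_S, Cmod_mult. simpl (2 ^ S m). rewrite Rmult_comm.
  apply Rmult_le_compat; try apply Cmod_ge_0; [| exact IH].
  eapply Rle_trans; [apply Cmod_triangle|]. rewrite Cmod_1, Cmod_pow.
  assert (Cmod z ^ (2 ^ S m) <= 1); [| lra].
  rewrite <- (pow1 (2 ^ S m)). apply pow_incr. split; [apply Cmod_ge_0|].
  apply Rlt_le, Hz.
Qed.

(** This is P(w), to be taken at w = z^(2^(n-1)). *)
Definition kernel_quotient (alpha : R) (w : C) : C :=
  (1 - w * w) * (1 + w * w + alpha * w) / (1 + w * w * (w * w)).

Lemma disk_pow4_neq (w : C) : disk w -> (1 + w * w * (w * w) <> 0)%C.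
Proof.
intros Hw E. assert (Hm : Cmod (w * w * (w * w)) = 1).
{ replace (w * w * (w * w))%C with (- (1))%C; [apply Cmod_m1|].
  replace (w * w * (w * w))%C with (1 + w * w * (w * w) - 1)%C by ring.
  rewrite E. ring. }
rewrite !Cmod_mult in Hm. assert (w0 := Cmod_ge_0 w). unfold disk in Hw.
assert (Cmod w * Cmod w < 1) by nra. nra.
Qed.

Lemma disk_pow (z : C) (m : nat) : disk z -> (1 <= m)%nat -> Cmod (Cpow z m) <= Cmod z.
Proof.
intros Hz Hm. rewrite Cmod_pow. destruct m as [| m]; [lia|]. simpl.
assert (z0 := Cmod_ge_0 z). unfold disk in Hz.
assert (Cmod z ^ m <= 1).
{ rewrite <- (pow1 m). apply pow_incr. lra. }
nra.
Qed.

Lemma two_pow_pos (m : nat) : (1 <= 2 ^ m)%nat.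
Proof. induction m; simpl; lia. Qed.

(** The factor 1 - z^2 telescopes the product to 1 - w^2, after which [n] enters only through
    [w]. *)
Lemma phi_kernel_quotient (n : nat) (alpha : R) (z : C) : (1 <= n)%nat -> disk z ->
  ((1 - z * z) * phi_kernel n alpha z
   = z * kernel_quotient alpha (Cpow z (2 ^ (n - 1))))%C.
Proof.
intros Hn Hz. destruct n as [| n]; [lia|]. replace (S n - 1)%nat with n by lia.
unfold phi_kernel, kernel_quotient. replace (S n - 1)%nat with n by lia.
set (w := Cpow z (2 ^ n)).
assert (Hw : disk w).
{ unfold disk, w. eapply Rle_lt_trans; [apply disk_pow; [exact Hz | apply two_pow_pos]|exact Hz]. }
assert (E1 : (Cpow z (2 ^ S n) = w * w)%C).
{ change (2 ^ S n)%nat with (2 * 2 ^ n)%nat. apply Cpow_double. }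
assert (E2 : (Cpow z (2 ^ (S n + 1)) = w * w * (w * w))%C).
{ replace (S n + 1)%nat with (S (S n)) by lia.
  change (2 ^ S (S n))%nat with (2 * 2 ^ S n)%nat. rewrite Cpow_double, E1. ring. }
assert (T := telescoping_product z n). rewrite E1 in T. rewrite E1, E2, <- T.
field. apply disk_pow4_neq, Hw.
Qed.

(** Times |d|^2 > 0, with r = |w|, the real part is (1 - r^2) ((1 + r^2)(1 + r^4) + alpha v), where
    |v| <= r (1 + r^2)^2. *)
Lemma kernel_quotient_Re_pos (alpha : R) (w : C) : Rabs alpha <= 1 -> disk w ->
  0 < Re (kernel_quotient alpha w).
Proof.
intros Ha Hw. assert (N := disk_pow4_neq w Hw).
set (d := (1 + w * w * (w * w))%C) in *.
assert (d0 : 0 < Cmod d ^ 2) by (apply pow_lt, Cmod_gt_0, N).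
set (u := ((1 - w * w) * (1 + w * w + alpha * w))%C).
replace (kernel_quotient alpha w) with (RtoC (/ Cmod d ^ 2) * (u * Cconj d))%C.
2:{ unfold kernel_quotient. fold u d. rewrite RtoC_inv, Cmod2_conj by lra.
  field. split; [exact N|]. intros E. apply N.
  rewrite <- (Cconj_conj d), E. apply injective_projections; simpl; ring. }
rewrite re_scal_l. apply Rmult_lt_0_compat; [apply Rinv_0_lt_compat; exact d0|].
set (r := Cmod w). assert (r0 : 0 <= r) by apply Cmod_ge_0.
assert (r1 : r < 1) by exact Hw.
assert (r2 : r ^ 2 = Re w ^ 2 + Im w ^ 2) by apply Cmod2_alt.
assert (B1 : Rabs (Re w) <= r) by apply re_le_Cmod.
assert (B3 : Rabs (Re (w * w * w)%C) <= r * r * r).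
{ eapply Rle_trans; [apply re_le_Cmod|]. rewrite !Cmod_mult. apply Rle_refl. }
replace (Re (u * Cconj d)%C) with ((1 - r ^ 2) * ((1 + r ^ 2) * (1 + (r ^ 2) ^ 2)
  + alpha * (Re w * (1 + r ^ 2 + (r ^ 2) ^ 2) - Re (w * w * w)%C))).
2:{ rewrite r2. unfold u, d, Re, Im. simpl. ring. }
set (v := Re w * (1 + r ^ 2 + (r ^ 2) ^ 2) - Re (w * w * w)%C).
assert (V : Rabs v <= r * (1 + r ^ 2) ^ 2).
{ unfold v. eapply Rle_trans; [apply Rabs_triang|]. rewrite Rabs_Ropp, Rabs_mult.
  assert (P : 0 <= 1 + r ^ 2 + (r ^ 2) ^ 2) by nra.
  rewrite (Rabs_pos_eq _ P). nra. }
assert (AV : - (r * (1 + r ^ 2) ^ 2) <= alpha * v).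
{ assert (H : Rabs (alpha * v) <= r * (1 + r ^ 2) ^ 2).
  { rewrite Rabs_mult. generalize (Rabs_pos v) (Rabs_pos alpha). nra. }
  apply Rabs_le_between in H. lra. }
apply Rmult_lt_0_compat; [nra|].
(* The worst case |alpha| = 1 leaves 1 + r^4 - r - r^3 = (1 - r)(1 - r^3). *)
apply Rlt_le_trans with ((1 + r ^ 2) * ((1 - r) * (1 - r * r * r))); [| nra].
assert (0 < 1 - r * r) by nra.
repeat apply Rmult_lt_0_compat; nra.
Qed.

(** P(w) - 1 = w (alpha (1 - w^2) - 2 w^3) / (1 + w^4), where for |w| <= 1/2 the bracket is at most
    4 and the denominator at least 1/2 in modulus. *)
Lemma kernel_quotient_near_0 (alpha : R) (w : C) : Rabs alpha <= 1 -> Cmod w <= 1 / 2 ->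
  Cmod (kernel_quotient alpha w - 1) <= 8 * Cmod w.
Proof.
intros Ha Hw. assert (w0 := Cmod_ge_0 w).
assert (N := disk_pow4_neq w ltac:(unfold disk; lra)).
set (d := (1 + w * w * (w * w))%C) in *.
assert (Hd : 1 / 2 <= Cmod d).
{ assert (T := Cmod_triangle d (- (w * w * (w * w)))).
  replace (d + - (w * w * (w * w)))%C with (RtoC 1) in T by (unfold d; ring).
  rewrite Cmod_1, Cmod_opp, !Cmod_mult in T.
  assert (Cmod w * Cmod w <= 1 / 4) by nra. nra. }
replace (kernel_quotient alpha w - 1)%C
  with (w * (- (w * w * w) - (w * w * w) + alpha * (1 - w * w)) / d)%C
  by (unfold kernel_quotient; fold d; unfold d in N |- *; field; exact N).
rewrite Cmod_div, Cmod_mult by exact N.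
assert (B : Cmod (- (w * w * w) - (w * w * w) + alpha * (1 - w * w)) <= 4).
{ eapply Rle_trans; [apply Cmod_triangle|].
  assert (B1 := Cmod_triangle (- (w * w * w)) (- (w * w * w))).
  assert (B2 := Cmod_triangle 1 (- (w * w))).
  rewrite Cmod_mult, Cmod_R.
  rewrite Cmod_opp, !Cmod_mult in B1. rewrite Cmod_opp, Cmod_1, Cmod_mult in B2.
  assert (Q : Cmod w * Cmod w <= 1 / 4) by nra.
  assert (Q3 : Cmod w * Cmod w * Cmod w <= 1 / 8) by nra.
  assert (A0 := Rabs_pos alpha). assert (C0 := Cmod_ge_0 (1 + - (w * w))).
  change (1 - w * w)%C with (1 + - (w * w))%C.
  change (- (w * w * w) - w * w * w)%C with (- (w * w * w) + - (w * w * w))%C.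
  assert (A1 := Rmult_le_compat_r _ _ _ C0 Ha). lra. }
apply Rmult_le_reg_r with (Cmod d); [lra|].
unfold Rdiv. rewrite Rmult_assoc, Rinv_l by lra.
assert (B0 := Cmod_ge_0 (- (w * w * w) - (w * w * w) + alpha * (1 - w * w))).
nra.
Qed.

(** * The kernel near 0 and near the boundary points 1 and -1 *)

Lemma phi_kernel_0 (n : nat) (alpha : R) : phi_kernel n alpha 0 = 0%C.
Proof. unfold phi_kernel, Cdiv. rewrite !Cmult_0_l. reflexivity. Qed.

Lemma phi_kernel_derive_0 (n : nat) (alpha : R) : (1 <= n)%nat -> Rabs alpha <= 1 ->
  is_derive_C (phi_kernel n alpha) (RtoC 0) (RtoC 1).
Proof.
intros Hn Ha. apply is_derive_C_eps. intros eps Heps.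
(* For |z| <= 1/2, |1 - z^2| >= 1/2 and |(1 - z^2)(Phi(z) - z)| <= 9 |z|^2, hence |Phi(z) - z| <= 18
   |z|^2. *)
exists (Rmin (1 / 2) (eps / 18)). split; [apply Rmin_pos; lra|].
intros z Hz. rewrite phi_kernel_0.
replace (phi_kernel n alpha z - 0 - 1 * (z - 0))%C with (phi_kernel n alpha z - z)%C by ring.
replace (z - 0)%C with z in * by ring.
assert (H1 := Rlt_le_trans _ _ _ Hz (Rmin_l _ _)).
assert (H2 := Rlt_le_trans _ _ _ Hz (Rmin_r _ _)).
assert (z0 := Cmod_ge_0 z). assert (Dz : disk z) by (unfold disk; lra).
assert (E := phi_kernel_quotient n alpha z Hn Dz).
set (w := Cpow z (2 ^ (n - 1))) in *.
assert (Hw : Cmod w <= Cmod z) by (apply disk_pow; [exact Dz | apply two_pow_pos]).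
assert (B := kernel_quotient_near_0 alpha w Ha ltac:(lra)).
assert (B2 : 1 / 2 <= Cmod (1 - z * z)).
{ assert (T := Cmod_triangle (1 - z * z) (z * z)).
  replace (1 - z * z + z * z)%C with (RtoC 1) in T by ring.
  rewrite Cmod_1, Cmod_mult in T. nra. }
assert (M : Cmod (1 - z * z) * Cmod (phi_kernel n alpha z - z)
  <= Cmod z * (8 * Cmod z + Cmod z)).
{ rewrite <- Cmod_mult.
  replace ((1 - z * z) * (phi_kernel n alpha z - z))%C
    with (z * ((kernel_quotient alpha w - 1) + z * z))%C.
  - rewrite Cmod_mult. apply Rmult_le_compat_l; [exact z0|].
    eapply Rle_trans; [apply Cmod_triangle|]. rewrite Cmod_mult. nra.
  - transitivity ((1 - z * z) * phi_kernel n alpha z - (1 - z * z) * z)%C; [| ring].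
    rewrite E. ring. }
assert (P0 := Cmod_ge_0 (phi_kernel n alpha z - z)). nra.
Qed.

Lemma Cpow_minus_1_bound (z : C) (m : nat) : Cmod z <= 1 ->
  Cmod (Cpow z m - 1) <= INR m * Cmod (z - 1).
Proof.
intros Hz. induction m as [| m IH].
- simpl. replace (1 - 1)%C with (RtoC 0) by ring. rewrite Cmod_0. lra.
- rewrite S_INR. simpl Cpow.
  replace (z * Cpow z m - 1)%C with (z * (Cpow z m - 1) + (z - 1))%C by ring.
  eapply Rle_trans; [apply Cmod_triangle|]. rewrite Cmod_mult.
  assert (Z := Cmod_ge_0 (Cpow z m - 1)). assert (Z1 := Cmod_ge_0 z). nra.
Qed.

(** The zeros of the denominator stay away from 1 and -1: near either point z^2 is within 1/m of 1,
    so (z^2)^m is within 1 of 1 and 1 + (z^2)^m has modulus at least 1. *)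
Lemma phi_kernel_bounded (n : nat) (alpha : R) : Rabs alpha <= 1 ->
  exists d M, 0 < d /\ 0 <= M /\ forall z, disk z ->
    Cmod (z - 1) < d \/ Cmod (z + 1) < d -> Cmod (phi_kernel n alpha z) <= M.
Proof.
intros Ha. set (m := (2 ^ n)%nat).
assert (m1 : 1 <= INR m) by (apply (le_INR 1), two_pow_pos).
(* With this radius |z - 1| |z + 1| <= 1/m, as the other factor is at most 2. The bound 3 is for the
   trinomial, 2^(n-1) for the product. *)
exists (/ (2 * INR m)), (3 * 2 ^ (n - 1)). split; [apply Rinv_0_lt_compat; lra|].
split; [assert (H := pow_lt 2 (n - 1)); lra|].
intros z Hz Hd. assert (z0 := Cmod_ge_0 z).
assert (Hm : Cmod (z * z - 1) * INR m <= 1).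
{ replace (z * z - 1)%C with ((z - 1) * (z + 1))%C by ring. rewrite Cmod_mult.
  assert (T1 := Cmod_triangle z (- (1))). assert (T2 := Cmod_triangle z 1).
  rewrite Cmod_m1 in T1. rewrite Cmod_1 in T2. unfold disk in Hz.
  change (z + - (1))%C with (z - 1)%C in T1.
  assert (P1 := Cmod_ge_0 (z - 1)). assert (P2 := Cmod_ge_0 (z + 1)).
  assert (HH : Cmod (z - 1) * Cmod (z + 1) <= 2 * / (2 * INR m)) by (destruct Hd; nra).
  apply Rmult_le_compat_r with (r := INR m) in HH; [| lra].
  replace (2 * / (2 * INR m) * INR m) with 1 in HH by (field; lra). exact HH. }
unfold phi_kernel.
replace (2 ^ (n + 1))%nat with (2 * m)%nat by (unfold m; rewrite Nat.add_1_r; reflexivity).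
rewrite Cpow_mult_r.
assert (Pb : forall k, Cmod (Cpow z k) <= 1).
{ intros k. rewrite Cmod_pow, <- (pow1 k). apply pow_incr. unfold disk in Hz. lra. }
assert (Hden : 1 <= Cmod (1 + Cpow (Cpow z 2) m)).
{ assert (Z2 : (Cpow z 2 = z * z)%C) by (simpl; ring).
  assert (B := Cpow_minus_1_bound (Cpow z 2) m (Pb 2%nat)).
  rewrite Z2 in B |- *.
  assert (T := Cmod_triangle (1 + Cpow (z * z) m) (- (Cpow (z * z) m - 1))).
  replace (1 + Cpow (z * z) m + - (Cpow (z * z) m - 1))%C with (RtoC 2) in T
    by (apply injective_projections; simpl; ring).
  rewrite Cmod_opp, Cmod_R, Rabs_pos_eq in T by lra. lra. }
assert (N : (1 + Cpow (Cpow z 2) m <> 0)%C) by (apply Cmod_gt_0; lra).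
rewrite Cmod_div by exact N.
apply Rmult_le_reg_r with (Cmod (1 + Cpow (Cpow z 2) m)); [lra|].
unfold Rdiv. rewrite Rmult_assoc, Rinv_l, Rmult_1_r by lra.
rewrite !Cmod_mult.
assert (B1 := product_bound z (n - 1) Hz).
set (Q := Cmod (iter_nat _ _ _ _ _)) in *. assert (Q0 : 0 <= Q) by apply Cmod_ge_0.
assert (B2 : Cmod (1 + Cpow z m + alpha * Cpow z (2 ^ (n - 1))) <= 3).
{ eapply Rle_trans; [apply Cmod_triangle|].
  assert (T := Cmod_triangle 1 (Cpow z m)). rewrite Cmod_1 in T.
  rewrite Cmod_mult, Cmod_R.
  assert (P1 := Pb m). assert (P2 := Pb (2 ^ (n - 1))%nat).
  assert (P3 := Cmod_ge_0 (Cpow z (2 ^ (n - 1)))). assert (P4 := Rabs_pos alpha). nra. }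
fold m. set (Y := Cmod (1 + Cpow z m + _)) in *. assert (Y0 : 0 <= Y) by apply Cmod_ge_0.
unfold disk in Hz.
assert (S1 : Cmod z * Q <= 2 ^ (n - 1)) by nra.
assert (S2 : 0 <= Cmod z * Q) by nra.
nra.
Qed.

(** Away from 0, (1 - z^2) H' is P(w); at 0, H' equals the derivative of the kernel, which is 1. *)
Lemma hadamard_phi_kernel_dir (n : nat) (alpha : R) (H : C -> C) (z p : C) :
  (1 <= n)%nat -> Rabs alpha <= 1 ->
  is_hadamard_product (phi_kernel n alpha) log_kernel H -> disk z ->
  is_derive_C H z p ->
  0 < Re ((1 - z * z) * p).
Proof.
intros Hn Ha HF Hz HH.
destruct (classic (z = 0)) as [E | N].
- subst z.
  rewrite (hadamard_log_derive_0 _ _ p 1 HF HH (phi_kernel_derive_0 n alpha Hn Ha)).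
  unfold Re; simpl. lra.
- assert (E := phi_kernel_quotient n alpha z Hn Hz).
  rewrite <- (hadamard_log_derive _ _ _ _ HF Hz HH) in E.
  set (w := Cpow z (2 ^ (n - 1))) in *.
  assert (Hw : disk w).
  { eapply Rle_lt_trans; [apply disk_pow; [exact Hz | apply two_pow_pos] | exact Hz]. }
  replace ((1 - z * z) * p)%C with (kernel_quotient alpha w).
  + apply kernel_quotient_Re_pos; assumption.
  + transitivity (/ z * (z * kernel_quotient alpha w))%C; [field; exact N|].
    rewrite <- E. field. exact N.
Qed.

Lemma hadamard_phi_kernel_derive_eq (n : nat) (alpha : R) (H1 H2 : C -> C) (z p1 p2 : C) :
  (1 <= n)%nat -> Rabs alpha <= 1 ->
  is_hadamard_product (phi_kernel n alpha) log_kernel H1 ->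
  is_hadamard_product (phi_kernel n alpha) log_kernel H2 -> disk z ->
  is_derive_C H1 z p1 ->
  is_derive_C H2 z p2 -> p1 = p2.
Proof.
intros Hn Ha F1 F2 Hz D1 D2.
destruct (classic (z = 0)) as [E | N].
- subst z. assert (D := phi_kernel_derive_0 n alpha Hn Ha).
  rewrite (hadamard_log_derive_0 _ _ _ _ F1 D1 D).
  symmetry. exact (hadamard_log_derive_0 _ _ _ _ F2 D2 D).
- transitivity (/ z * (z * p1))%C; [field; exact N|].
  rewrite (hadamard_log_derive _ _ _ _ F1 Hz D1), <- (hadamard_log_derive _ _ _ _ F2 Hz D2).
  field. exact N.
Qed.

(** From z H' = Phi, with |z| >= 1/2 near 1 and -1, which costs the factor 2. *)
Lemma hadamard_phi_kernel_bounded (n : nat) (alpha : R) (H hd : C -> C) :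
  Rabs alpha <= 1 ->
  is_hadamard_product (phi_kernel n alpha) log_kernel H ->
  (forall z, disk z -> is_derive_C H z (hd z)) ->
  exists d M, 0 < d /\ 0 <= M /\ forall z, disk z ->
    Cmod (z - 1) < d \/ Cmod (z + 1) < d -> Cmod (hd z) <= M.
Proof.
intros Ha HF HH.
destruct (phi_kernel_bounded n alpha Ha) as (d & M & d0 & M0 & HM).
exists (Rmin d (1 / 2)), (2 * M). split; [apply Rmin_pos; lra|]. split; [lra|].
intros z Hz Hd.
assert (l1 := Rmin_l d (1 / 2)). assert (l2 := Rmin_r d (1 / 2)).
assert (B : Cmod (phi_kernel n alpha z) <= M) by (apply HM; [exact Hz | destruct Hd; lra]).
rewrite <- (hadamard_log_derive _ _ _ _ HF Hz (HH z Hz)), Cmod_mult in B.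
assert (Z : 1 / 2 <= Cmod z).
{ destruct Hd as [Hd | Hd].
  - assert (T := Cmod_triangle z (- (z - 1))).
    replace (z + - (z - 1))%C with (RtoC 1) in T by ring.
    rewrite Cmod_1, Cmod_opp in T. lra.
  - assert (T := Cmod_triangle (- z) (z + 1)).
    replace (- z + (z + 1))%C with (RtoC 1) in T by ring.
    rewrite Cmod_1, Cmod_opp in T. lra. }
assert (P := Cmod_ge_0 (hd z)). nra.
Qed.

(** * Transfer to the disk *)

(** Inverse of q = (1 + z) / (1 - z); the ends 0 and infinity of every ray go to -1 and 1. *)
Definition cayley (q : C) : C := (q - 1) / (q + 1).

Lemma half_plane_neq (q : C) : 0 < Re q -> (q + 1 <> 0)%C.
Proof. intros Hq E. apply (f_equal Re) in E. unfold Re in *; simpl in *. lra. Qed.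

Lemma half_plane_Cmod (q : C) : 0 < Re q -> 1 + Re q <= Cmod (q + 1).
Proof.
intros Hq. assert (B := re_le_Cmod (q + 1)).
replace (Re (q + 1)%C) with (1 + Re q) in B by (unfold Re; simpl; ring).
rewrite Rabs_pos_eq in B by lra. exact B.
Qed.

Lemma cayley_derive (q : C) : 0 < Re q ->
  is_derive_C cayley q (2 / ((q + 1) * (q + 1)))%C.
Proof.
intros Hq. apply is_derive_C_eps. intros eps Heps.
(* The first bound keeps [w] in the half-plane, where the denominators have modulus at least 1; the
   second absorbs the factor 2 of the exact remainder. *)
exists (Rmin (Re q) (eps / 2)). split; [apply Rmin_pos; lra|]. intros w Hw.
assert (H1 := Rlt_le_trans _ _ _ Hw (Rmin_l _ _)).
assert (H2 := Rlt_le_trans _ _ _ Hw (Rmin_r _ _)).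
assert (Hw0 : 0 < Re w).
{ assert (B := re_le_Cmod (w - q)). apply Rabs_le_between in B.
  replace (Re (w - q)%C) with (Re w - Re q) in B by (unfold Re; simpl; ring). lra. }
assert (Nq := half_plane_neq q Hq). assert (Nw := half_plane_neq w Hw0).
assert (Bq := half_plane_Cmod q Hq). assert (Bw := half_plane_Cmod w Hw0).
replace (cayley w - cayley q - 2 / ((q + 1) * (q + 1)) * (w - q))%C
  with ((w - q) * (- (2) * (w - q)) / ((w + 1) * ((q + 1) * (q + 1))))%C
  by (unfold cayley; field; split; assumption).
rewrite Cmod_div by (repeat apply Cmult_neq_0; assumption).
rewrite !Cmod_mult, Cmod_opp, Cmod_R, Rabs_pos_eq by lra.
set (D := Cmod (w - q)) in *. assert (D0 : 0 <= D) by apply Cmod_ge_0.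
assert (P : 1 <= Cmod (w + 1) * (Cmod (q + 1) * Cmod (q + 1))).
{ assert (1 <= Cmod (q + 1) * Cmod (q + 1)) by nra. nra. }
apply Rmult_le_reg_r with (Cmod (w + 1) * (Cmod (q + 1) * Cmod (q + 1))); [lra|].
unfold Rdiv. rewrite Rmult_assoc, Rinv_l, Rmult_1_r by lra.
apply Rle_trans with (eps * D * 1); [nra|].
apply Rmult_le_compat_l; [nra | exact P].
Qed.

(** |q + 1|^2 - |q - 1|^2 = 4 Re q. *)
Lemma cayley_disk (q : C) : 0 < Re q -> disk (cayley q).
Proof.
intros Hq. assert (N := half_plane_neq q Hq). assert (B := half_plane_Cmod q Hq).
unfold disk, cayley. rewrite Cmod_div by exact N.
apply Rmult_lt_reg_r with (Cmod (q + 1)); [lra|].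
unfold Rdiv. rewrite Rmult_assoc, Rinv_l by lra. rewrite Rmult_1_r, Rmult_1_l.
apply Rsqr_incrst_0; try apply Cmod_ge_0.
rewrite !Rsqr_pow2, !Cmod2_alt. unfold Re, Im in *; simpl. nra.
Qed.

(** Re ((1 + z) conj(1 - z)) = 1 - |z|^2. *)
Lemma cayley_onto (z : C) : disk z -> exists q, 0 < Re q /\ cayley q = z.
Proof.
intros Hz. assert (N : (1 - z <> 0)%C).
{ intros E. assert (E' : z = 1%C).
  { transitivity (1 - (1 - z))%C; [ring | rewrite E; ring]. }
  unfold disk in Hz. rewrite E', Cmod_1 in Hz. lra. }
assert (N2 : (RtoC 2 <> 0)%C) by (intros E; apply (f_equal Re) in E; simpl in E; lra).
exists ((1 + z) / (1 - z))%C. split.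
- assert (D0 : 0 < Cmod (1 - z) ^ 2) by (apply pow_lt, Cmod_gt_0, N).
  replace ((1 + z) / (1 - z))%C
    with (RtoC (/ Cmod (1 - z) ^ 2) * ((1 + z) * Cconj (1 - z)))%C.
  + rewrite re_scal_l. apply Rmult_lt_0_compat; [apply Rinv_0_lt_compat, D0|].
    assert (Z : Cmod z ^ 2 < 1) by (unfold disk in Hz; generalize (Cmod_ge_0 z); nra).
    rewrite Cmod2_alt in Z. unfold Re, Im in *; simpl in *. nra.
  + rewrite RtoC_inv, Cmod2_conj by lra. field. split; [exact N|].
    intros E. apply N. rewrite <- (Cconj_conj (1 - z)), E.
    apply injective_projections; simpl; ring.
- unfold cayley. field. split; [exact N|].
  intros E. apply N2. rewrite <- E. ring.
Qed.

Lemma cayley_minus_1 (q : C) : 0 < Re q -> Cmod (cayley q - 1) * Re q <= 2.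
Proof.
intros Hq. assert (N := half_plane_neq q Hq). assert (B := half_plane_Cmod q Hq).
replace (cayley q - 1)%C with (- (2) / (q + 1))%C by (unfold cayley; field; exact N).
rewrite Cmod_div, Cmod_opp, Cmod_R, Rabs_pos_eq by (lra || exact N).
apply Rmult_le_reg_r with (Cmod (q + 1)); [lra|].
unfold Rdiv. rewrite Rmult_assoc, (Rmult_comm (Re q)), <- Rmult_assoc.
rewrite (Rmult_assoc 2), Rinv_l by lra. lra.
Qed.

Lemma cayley_plus_1 (q : C) : 0 < Re q -> Cmod (cayley q + 1) <= 2 * Cmod q.
Proof.
intros Hq. assert (N := half_plane_neq q Hq). assert (B := half_plane_Cmod q Hq).
replace (cayley q + 1)%C with (2 * q / (q + 1))%C by (unfold cayley; field; exact N).
rewrite Cmod_div, Cmod_mult, Cmod_R, Rabs_pos_eq by (lra || exact N).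
apply Rmult_le_reg_r with (Cmod (q + 1)); [lra|].
unfold Rdiv. rewrite Rmult_assoc, Rinv_l by lra.
assert (P := Cmod_ge_0 q). nra.
Qed.

Lemma segment_ball (c z z' : C) (d s : R) : 0 <= s <= 1 ->
  Cmod (z - c) < d -> Cmod (z' - c) < d -> Cmod (z' + s * (z - z') - c) < d.
Proof.
intros Hs Hz Hz'.
replace (z' + s * (z - z') - c)%C with (s * (z - c) + RtoC (1 - s) * (z' - c))%C
  by (rewrite RtoC_minus; ring).
eapply Rle_lt_trans; [apply Cmod_triangle|].
rewrite !Cmod_mult, !Cmod_R, !Rabs_pos_eq by lra.
destruct (Req_dec s 0) as [-> | N]; [lra|].
assert (L1 := Rmult_lt_compat_l s _ _ ltac:(lra) Hz).
assert (L2 := Rmult_le_compat_l (1 - s) _ _ ltac:(lra) (Rlt_le _ _ Hz')). lra.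
Qed.

(** The part of the disk near [c] is convex and H' is bounded by [M] there, so the mean value bound
    makes Re H Lipschitz. *)
Lemma boundary_oscillation (H hd : C -> C) (c : C) (d M : R) :
  (forall z, disk z -> is_derive_C H z (hd z)) ->
  0 < d -> 0 <= M -> (forall z, disk z -> Cmod (z - c) < d -> Cmod (hd z) <= M) ->
  forall eps, 0 < eps -> exists e, 0 < e /\ forall z z', disk z -> disk z' ->
    Cmod (z - c) < e -> Cmod (z' - c) < e -> Re (H z) < Re (H z') + eps.
Proof.
intros HH d0 M0 HM eps Heps.
assert (r0 : 0 < eps / (2 * (M + 1))) by (apply Rdiv_lt_0_compat; lra).
assert (Er : eps / (2 * (M + 1)) * (2 * (M + 1)) = eps) by (field; lra).
set (r := eps / (2 * (M + 1))) in *.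
exists (Rmin d r). split; [apply Rmin_pos; assumption|].
assert (l1 := Rmin_l d r). assert (l2 := Rmin_r d r).
intros z z' Hz Hz' B B'.
assert (V := Re_mean_value H hd M z z').
assert (V' : Re (H z) - Re (H z') <= M * Cmod (z - z')).
{ apply V. intros s Hs.
  assert (Ds : disk (z' + s * (z - z'))%C).
  { assert (S := segment_ball 0 z z' 1 s Hs). unfold disk in *.
    replace (z - 0)%C with z in S by ring. replace (z' - 0)%C with z' in S by ring.
    replace (z' + s * (z - z') - 0)%C with (z' + s * (z - z'))%C in S by ring.
    apply S; assumption. }
  split; [apply HH, Ds|]. apply HM; [exact Ds|].
  apply segment_ball; [exact Hs | lra | lra]. }
assert (T := Cmod_triangle (z - c) (- (z' - c))). rewrite Cmod_opp in T.
replace (z - c + - (z' - c))%C with (z - z')%C in T by ring.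
assert (Z := Cmod_ge_0 (z - z')). nra.
Qed.

Lemma shear_pair_cayley (H K hd kd : C -> C) :
  (forall z, disk z -> is_derive_C H z (hd z)) ->
  (forall z, disk z -> is_derive_C K z (kd z)) ->
  (forall z, disk z -> 0 < Re ((1 - z * z) * hd z)) ->
  (forall z, disk z -> 0 < Re (kd z * Cconj (hd z))) ->
  (exists d M, 0 < d /\ 0 <= M /\ forall z, disk z ->
    Cmod (z - 1) < d \/ Cmod (z + 1) < d -> Cmod (hd z) <= M) ->
  shear_pair (fun q => H (cayley q)) (fun q => K (cayley q))
    (fun q => hd (cayley q) * (2 / ((q + 1) * (q + 1))))%C
    (fun q => kd (cayley q) * (2 / ((q + 1) * (q + 1))))%C.
Proof.
intros HH HK Hdir Hdil (d & M & d0 & M0 & HM). split.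
- intros q Hq. apply (is_derive_C_comp H cayley); [apply HH, cayley_disk, Hq|].
  apply cayley_derive, Hq.
- intros q Hq. apply (is_derive_C_comp K cayley); [apply HK, cayley_disk, Hq|].
  apply cayley_derive, Hq.
- intros q Hq. assert (N := half_plane_neq q Hq).
  (* For the Cayley map M, q M'(q) = (1 - M(q)^2) / 2. *)
  replace (q * (hd (cayley q) * (2 / ((q + 1) * (q + 1)))))%C
    with (RtoC (1 / 2) * ((1 - cayley q * cayley q) * hd (cayley q)))%C.
  + rewrite re_scal_l. apply Rmult_lt_0_compat; [lra|]. apply Hdir, cayley_disk, Hq.
  + generalize (hd (cayley q)). intros p. unfold cayley.
    rewrite RtoC_div by lra. field. exact N.
- intros q Hq. set (z := cayley q). set (c := (2 / ((q + 1) * (q + 1)))%C).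
  assert (Nc : (c <> 0)%C).
  { assert (N := half_plane_neq q Hq). intros E.
    assert (E2 : RtoC 2 = 0%C).
    { transitivity (c * ((q + 1) * (q + 1)))%C; [unfold c; field; exact N|].
      rewrite E. ring. }
    apply (f_equal Re) in E2; simpl in E2; lra. }
  (* Both derivatives carry the same factor c = M'(q), which contributes only |c|^2 > 0. *)
  replace (kd z * c * Cconj (hd z * c))%C
    with (RtoC (Cmod c ^ 2) * (kd z * Cconj (hd z)))%C
    by (rewrite Cmult_conj, Cmod2_conj; ring).
  rewrite re_scal_l. apply Rmult_lt_0_compat.
  + apply pow_lt, Cmod_gt_0, Nc.
  + apply Hdil, cayley_disk, Hq.
- intros m m' eps Heps.
  destruct (boundary_oscillation H hd 1 d M HH d0 M0) with (eps := eps)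
    as (e & e0 & He); [intros z Hz B; apply HM; tauto | exact Heps |].
  (* |M - 1| a <= 2 < 3 <= a e, uniformly in the slope. *)
  assert (b0 : 0 < 3 / e) by (apply Rdiv_lt_0_compat; lra).
  assert (Eb : 3 / e * e = 3) by (field; lra).
  exists (3 / e). split; [exact b0|]. intros a Ha.
  assert (a0 : 0 < a) by lra.
  assert (L : forall x, Cmod (cayley (ray a x) - 1) < e).
  { intros x. assert (B := cayley_minus_1 (ray a x) a0). unfold ray at 2, Re in B; simpl in B.
    assert (P := Cmod_ge_0 (cayley (ray a x) - 1)).
    apply Rmult_lt_reg_r with a; [exact a0|]. nra. }
  apply He; try apply cayley_disk; try exact a0; apply L.
- intros m m' eps Heps.
  destruct (boundary_oscillation H hd (- (1)) d M HH d0 M0) with (eps := eps)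
    as (e & e0 & He); [| exact Heps |].
  { intros z Hz B. apply HM; [exact Hz|]. right.
    replace (z + 1)%C with (z - - (1))%C by ring. exact B. }
  (* At 0 the bound 2 |q| depends on the slope; [s] dominates |q| / a for both slopes, and 2 a s < 3
     a s <= e. *)
  set (s := 1 + Rabs m + Rabs m'). assert (p := Rabs_pos m). assert (p' := Rabs_pos m').
  assert (s0 : 0 < s) by (unfold s; lra).
  assert (b0 : 0 < e / (3 * s)) by (apply Rdiv_lt_0_compat; lra).
  assert (Eb : e / (3 * s) * (3 * s) = e) by (field; lra).
  exists (e / (3 * s)). split; [exact b0|]. intros a [a0 Ha].
  assert (L : forall x, Rabs x <= s - 1 -> Cmod (cayley (ray a x) - - (1)) < e).
  { intros x Hx. assert (B := cayley_plus_1 (ray a x) a0).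
    replace (cayley (ray a x) - - (1))%C with (cayley (ray a x) + 1)%C by ring.
    assert (T : Cmod (ray a x) <= a * s).
    { replace (ray a x) with (RtoC a * (1 + Ci * x))%C
        by (unfold ray; apply injective_projections; simpl; ring).
      rewrite Cmod_mult, Cmod_R, Rabs_pos_eq by lra.
      apply Rmult_le_compat_l; [lra|].
      eapply Rle_trans; [apply Cmod_triangle|].
      rewrite Cmod_1, Cmod_mult, Cmod_Ci, Cmod_R. lra. }
    assert (T2 : a * (3 * s) <= e) by (rewrite <- Eb; nra).
    assert (0 < a * s) by nra. lra. }
  apply He; try apply cayley_disk; try exact a0; apply L; unfold s; lra.
Qed.

(** The real part is |a|^2 - |b|^2. The condition a + b <> 0 excludes a = b = 0, which |w| < 1 alone
    would allow. *)
Lemma dilatation_Re_pos (a b w : C) : b = (w * a)%C -> Cmod w < 1 -> (a + b <> 0)%C ->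
  0 < Re ((a - b) * Cconj (a + b)).
Proof.
intros E Hw N.
replace (Re ((a - b) * Cconj (a + b))) with (Cmod a ^ 2 - Cmod b ^ 2)
  by (rewrite !Cmod2_alt; unfold Re, Im; simpl; ring).
assert (a0 : 0 < Cmod a).
{ apply Cmod_gt_0. intros A0. apply N. rewrite E, A0. ring. }
rewrite E, Cmod_mult. assert (w0 := Cmod_ge_0 w).
assert (Cmod w * Cmod a < Cmod a) by nra.
assert (0 <= Cmod w * Cmod a) by nra. nra.
Qed.

(** * Convex combinations of two mappings sharing H' *)

Theorem theorem3p8 (n : nat) (alpha t : R)
  (h1 g1 w1 h2 g2 w2 : C -> C)
  (hn : (1 <= n)%nat)
  (halpha : (- (2 * (sqrt 2 - 1)) <= alpha <= 2 * (sqrt 2 - 1))%R)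
  (ht : (0 <= t <= 1)%R)
  (hh1 : analytic_on_disk h1) (hg1 : analytic_on_disk g1)
  (hh2 : analytic_on_disk h2) (hg2 : analytic_on_disk g2)
  (hnorm1 : normalized h1 g1) (hnorm2 : normalized h2 g2)
  (hsum1 : is_hadamard_product (phi_kernel n alpha) log_kernel
             (fun z => (h1 z + g1 z)%C))
  (hsum2 : is_hadamard_product (phi_kernel n alpha) log_kernel
             (fun z => (h2 z + g2 z)%C))
  (hdil1 : is_dilatation h1 g1 w1) (hdil2 : is_dilatation h2 g2 w2)
  (hw1 : forall z : C, disk z -> (Cmod (w1 z) < 1)%R)
  (hw2 : forall z : C, disk z -> (Cmod (w2 z) < 1)%R) :
  let f := fun z : C =>
    (t * harmonic_sum h1 g1 z + (1 - t) * harmonic_sum h2 g2 z)%C in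
  in_SH f /\ convex_imaginary_direction f.
Proof.
intros f.
(* sqrt 2 <= 3/2 gives 2 (sqrt 2 - 1) <= 1. *)
assert (Ha : Rabs alpha <= 1).
{ apply Rabs_le. assert (sqrt 2 <= 3 / 2); [| lra].
  rewrite <- (sqrt_Rsqr (3 / 2)) by lra. apply sqrt_le_1; unfold Rsqr; lra. }
set (h := fun z => (t * h1 z + (1 - t) * h2 z)%C).
set (g := fun z => (t * g1 z + (1 - t) * g2 z)%C).
set (dh := fun z => (t * C_derive h1 z + (1 - t) * C_derive h2 z)%C).
set (dg := fun z => (t * C_derive g1 z + (1 - t) * C_derive g2 z)%C).
(* Conjugation commutes with the weights because [t] is real. *)
assert (Ef : f = harmonic_sum h g).
{ apply functional_extensionality. intros z. unfold f, harmonic_sum, h, g.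
  apply injective_projections; simpl; ring. }
assert (Dh : forall z, disk z -> is_derive_C h z (dh z)).
{ intros z Hz. apply is_derive_C_lin; apply C_derive_spec; assumption. }
assert (Dg : forall z, disk z -> is_derive_C g z (dg z)).
{ intros z Hz. apply is_derive_C_lin; apply C_derive_spec; assumption. }
assert (Dsum : forall (u v : C -> C) z, analytic_on_disk u -> analytic_on_disk v -> disk z ->
  is_derive_C (fun z => u z + v z)%C z
    (C_derive u z + C_derive v z)%C).
{ intros u v z Hu Hv Hz.
  exact (is_derive_plus (K := C_AbsRing) (V := C_NormedModule) u v z _ _
    (C_derive_spec u z Hu Hz) (C_derive_spec v z Hv Hz)). }
assert (Eq : forall z, disk z -> (C_derive h1 z + C_derive g1 z = C_derive h2 z + C_derive g2 z)%C).
{ intros z Hz.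
  apply (hadamard_phi_kernel_derive_eq n alpha (fun z => h1 z + g1 z)%C
    (fun z => h2 z + g2 z)%C z); try assumption; apply Dsum; assumption. }
set (dH := fun z => (C_derive h1 z + C_derive g1 z)%C) in *.
assert (Esum : forall z, disk z -> (dh z + dg z = dH z)%C).
{ intros z Hz.
  transitivity (t * dH z + (1 - t) * (C_derive h2 z + C_derive g2 z))%C.
  - unfold dh, dg, dH. ring.
  - rewrite <- (Eq z Hz). unfold dH. ring. }
assert (DH : forall z, disk z ->
  is_derive_C (fun z => h z + g z)%C z (dH z)).
{ intros z Hz. rewrite <- (Esum z Hz).
  exact (is_derive_plus (K := C_AbsRing) (V := C_NormedModule) h g z _ _ (Dh z Hz) (Dg z Hz)). }
assert (DK : forall z, disk z ->
  is_derive_C (fun z => h z - g z)%C z (dh z - dg z)%C).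
{ intros z Hz.
  exact (is_derive_minus (K := C_AbsRing) (V := C_NormedModule) h g z _ _ (Dh z Hz) (Dg z Hz)). }
assert (Dir : forall z, disk z -> 0 < Re ((1 - z * z) * dH z)).
{ intros z Hz. apply (hadamard_phi_kernel_dir n alpha (fun z => h1 z + g1 z)%C);
    try assumption. apply Dsum; assumption. }
(* With H' common to both maps, this quantity is the convex combination of its values for the two
   maps, each positive. *)
assert (Dil : forall z, disk z -> 0 < Re ((dh z - dg z) * Cconj (dH z))).
{ intros z Hz.
  assert (N : (dH z <> 0)%C).
  { intros E. assert (P := Dir z Hz). rewrite E in P. unfold Re in P; simpl in P. lra. }
  assert (P1 := dilatation_Re_pos _ _ _ (proj2 hdil1 z Hz) (hw1 z Hz) N).
  assert (N2 := N). unfold dH in N2. rewrite (Eq z Hz) in N2.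
  assert (P2 := dilatation_Re_pos _ _ _ (proj2 hdil2 z Hz) (hw2 z Hz) N2).
  rewrite <- (Eq z Hz) in P2. fold (dH z) in P1, P2.
  replace ((dh z - dg z) * Cconj (dH z))%C
    with (t * ((C_derive h1 z - C_derive g1 z) * Cconj (dH z))
      + RtoC (1 - t) * ((C_derive h2 z - C_derive g2 z) * Cconj (dH z)))%C
    by (unfold dh, dg; rewrite RtoC_minus; ring).
  rewrite re_plus, !re_scal_l.
  destruct (Req_dec t 0) as [-> | Nt]; [lra | nra]. }
assert (Bd := hadamard_phi_kernel_bounded n alpha _ dH Ha hsum1
  (fun z Hz => Dsum h1 g1 z hh1 hg1 Hz)).
assert (Sh := shear_pair_cayley _ _ _ _ DH DK Dir Dil Bd).
(* The shear: h + conj(g) has the real part of h + g and the imaginary part of h - g. *)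
assert (Hf : forall z, f z = (Re (h z + g z), Im (h z - g z))).
{ intros z. rewrite Ef. unfold harmonic_sum.
  apply injective_projections; unfold Re, Im; simpl; ring. }
destruct hnorm1 as (h10 & g10 & dh10). destruct hnorm2 as (h20 & g20 & dh20).
assert (disk0 : disk 0) by (unfold disk; rewrite Cmod_0; lra).
split; [repeat split |].
- exists h, g. split; [| split].
  + intros z Hz. eexists. apply Dh, Hz.
  + intros z Hz. eexists. apply Dg, Hz.
  + intros z _. rewrite Ef. reflexivity.
- intros z Hz. exists (dh z), (Cconj (dg z)). split.
  + rewrite Ef. apply is_wirtinger_harmonic_sum; [apply Dh, Hz | apply Dg, Hz].
  (* Re ((h' - g') conj(h' + g')) is the Jacobian |h'|^2 - |g'|^2. *)
  + assert (P := Dil z Hz). rewrite <- (Esum z Hz) in P. rewrite Cmod_conj.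
    rewrite !Cmod2_alt. unfold Re, Im in *; simpl in *. lra.
- intros z1 z2 H1 H2 E.
  destruct (cayley_onto z1 H1) as (q1 & Q1 & <-).
  destruct (cayley_onto z2 H2) as (q2 & Q2 & <-).
  rewrite !Hf in E. injection E as E1 E2.
  f_equal. apply (shear_injective _ _ _ _ Sh); assumption.
- unfold f, harmonic_sum. rewrite h10, g10, h20, g20.
  apply injective_projections; simpl; ring.
- exists (Cconj (dg 0)). rewrite Ef.
  replace (RtoC 1) with (dh 0) by (unfold dh; rewrite dh10, dh20; ring).
  apply is_wirtinger_harmonic_sum; [apply Dh, disk0 | apply Dg, disk0].
- intros c E.
  apply (shear_level_connected _ _ _ _ Sh E c).
  intros w. split.
  + intros [Ew (z & Hz & <-)]. split; [exact Ew|].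
    destruct (cayley_onto z Hz) as (q & Q & <-). exists q. split; [exact Q | apply Hf].
  + intros [Ew (q & Q & ->)]. split; [exact Ew|].
    exists (cayley q). split; [apply cayley_disk, Q | apply Hf].
Qed.
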